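(* Assume pairwise non-dominance. There are absolute constants $C_{pad}$ (entering the definition of $N_{pad}$ below) and $C$ such that for every $N\geq\max(N_{boot},N_{pad})$ there exists a BIC bandit algorithm whose number of rounds is fixed in advance (depending only on the priors and $N$), which almost surely collects at least $N$ samples of each arm, and whose number of rounds is at most $$C\,K\,N\,G_{pad}^{-1}\log\big(G_{pad}^{-1}\,p_{boot}^{-1}\big).$$
   Context: Incentivized exploration model: $K$ arms and rounds $t=1,2,\dots$; mean rewards $\mu_1,\dots,\mu_K\in[0,1]$ drawn independently, $\mu_i\sim\mathcal P_i$, with priors known to all. Bernoulli rewards: given the means, each arm $i$ has an i.i.d. sequence of $\{0,1\}$-valued samples with mean $\mu_i$; the $n$-th time arm $i$ is chosen its $n$-th sample is observed. Each round the algorithm recommends $A_t$, the agent chooses $A'_t$ and the reward is observed by the algorithm only. With $\mathcal E_{t-1}=\{A'_s=A_s\ \forall s<t\}$, the algorithm is BIC if for all rounds $t$ and arms $i,j$ with $\Pr[A_t=i]>0$, $\mathbb E[\mu_i-\mu_j\mid A_t=i,\mathcal E_{t-1}]\geq0$. Arms are indexed so that the prior means $\mu_i^0=\mathbb E[\mu_i]$ satisfy $\mu_1^0\geq\dots\geq\mu_K^0$. Pairwise non-dominance: $\Pr[\mu_j<\mu_i^0]>0$ for all $i\neq j$. $\Delta_k$ is the set of distributions over arms $1,\dots,k$, and for $q\in\Delta_k$, $\mu_q=\sum_i q_i\mu_i$. Parameters: $G_{pad}=\min_{j\in\{2,\dots,K\},\,q\in\Delta_{j-1}}\mathbb E[(\mu_j-\mu_q)_+]$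 and $N_{pad}=C_{pad}G_{pad}^{-2}\log(G_{pad}^{-1})$. For $N_0\in\mathbb N$ and an arm $j$, $\mathrm{ZEROS}_{j,N_0}$ is the event that the first $N_0$ samples of each arm $i<j$ are all $0$. $N_{boot}=\min\{N_0\in\mathbb N: \mathbb E[\mu_j-\mu_i\mid\mathrm{ZEROS}_{j,N_0}]>0 \text{ for all arms } j \text{ and all } i<j\}$, and $p_{boot}=\Pr[\mathrm{ZEROS}_{K,N_{boot}}]$. *)

(* Defs.v *)
From HB Require Import structures.
From mathcomp Require Import all_boot all_order all_algebra.
From mathcomp Require Import all_classical all_reals all_analysis.
Set Implicit Arguments. Unset Strict Implicit. Unset Printing Implicit Defensive.
Import Order.TTheory GRing.Theory Num.Theory.
Import numFieldNormedType.Exports.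
Local Open Scope classical_set_scope.
Local Open Scope ring_scope.

Section IncExp.
Context {d : measure_display} {Omega : measurableType d} {R : realType}.
Variable (P : probability Omega R).
Variable (K : nat).
(* mu i w : the (random) mean reward of arm i (arms are 0-indexed here). *)
Variable (mu : 'I_K -> Omega -> R).

Definition Ex (f : Omega -> R) : R := Rintegral P setT f.

Definition indep_means : Prop :=
  forall B : 'I_K -> set R, (forall i, measurable (B i)) ->
    P [set w | forall i, B i (mu i w)] = (\prod_(i < K) fine (P (mu i @^-1` B i)))%:E.

Definition prior_mean (i : 'I_K) : R := Ex (mu i).

Definition pairwise_non_dominance : Prop :=
  forall i j : 'I_K, i != j -> (0 < P [set w | (mu j w < prior_mean i)%R])%E.

(* Sample tables: for each arm i, its first M Bernoulli samples. *)
Definition table (M : nat) := {ffun 'I_K -> M.-tuple bool}.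

Definition table_lik (M : nat) (w : Omega) (x : table M) : R :=
  \prod_(i < K) \prod_(n < M) (if tnth (x i) n then mu i w else 1 - mu i w).

Definition Esamp (M : nat) (F : Omega -> table M -> R) : R :=
  Ex (fun w => \sum_(x : table M) table_lik w x * F w x).

(* ZEROS_{j,N0} (arm j given 0-indexed as j0): the first N0 samples of every
   arm i < j0 are 0. *)
Definition zeros (j0 N0 : nat) (x : table N0) : bool :=
  [forall i : 'I_K, (i < j0)%N ==> all (fun b => ~~ b) (x i)].

Definition ind (b : bool) : R := if b then 1 else 0.

Definition condE_zeros (j0 N0 : nat) (X : Omega -> R) : R :=
  Esamp (M:=N0) (fun w x => X w * ind (zeros j0 x))
  / Esamp (M:=N0) (fun _ x => ind (zeros j0 x)).

Definition boot_cond (N0 : nat) : Prop :=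
  forall i j : 'I_K, (i < j)%N ->
    0 < condE_zeros j N0 (fun w => mu j w - mu i w).

Definition is_Nboot (Nb : nat) : Prop :=
  boot_cond Nb /\ forall N0, boot_cond N0 -> (Nb <= N0)%N.

(* p_boot = Pr[ZEROS_{K, N_boot}] (arms 1..K-1 in 1-based indexing). *)
Definition p_boot (Nb : nat) : R := Esamp (M:=Nb) (fun _ x => ind (zeros K.-1 x)).

(* G_pad = min over arms j >= 2 and q in Delta_{j-1} of E[(mu_j - mu_q)_+]. *)
Definition G_pad : R :=
  inf [set g | exists (j : 'I_K) (q : 'I_K -> R),
    [/\ (0 < j)%N, (forall i, 0 <= q i), (forall i : 'I_K, (j <= i)%N -> q i = 0),
        \sum_(i < K) q i = 1 &
        g = Ex (fun w => Num.max (mu j w - \sum_(i < K) q i * mu i w) 0)]].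

Definition N_pad (Cpad : R) : R := Cpad * G_pad ^- 2 * ln (G_pad^-1).

(* Observed history: the list of (recommended arm, observed reward). A
   (behavioural) randomized algorithm maps each history to a distribution
   over arms for the next recommendation. *)
Definition history := seq ('I_K * bool).
Definition policy := history -> 'I_K -> R.

Definition valid_policy (pi : policy) : Prop :=
  forall h, (forall i, 0 <= pi h i) /\ \sum_(i < K) pi h i = 1.

(* History produced by the sequence of chosen arms s when the agents follow:
   the n-th time arm a is chosen, its n-th sample is observed. *)
Fixpoint hist_aux (M : nat) (x : table M) (cnt : 'I_K -> nat) (s : seq 'I_K)
  : history :=
  match s with
  | [::] => [::]
  | a :: s' => (a, nth false (x a) (cnt a))
               :: hist_aux x (fun i => if i == a then (cnt i).+1 else cnt i) s'
  end.
Definition hist (M : nat) (x : table M) (s : seq 'I_K) : history :=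
  hist_aux x (fun _ => 0%N) s.

Definition traj_weight (T : nat) (pi : policy) (x : table T) (s : T.-tuple 'I_K) : R :=
  \prod_(k < T) pi (hist x (take k s)) (tnth s k).

(* Expectation over means, samples and the algorithm's randomness, for a
   T-round run (all agents following the recommendations). *)
Definition Erun (T : nat) (pi : policy) (F : Omega -> table T -> T.-tuple 'I_K -> R) : R :=
  Ex (fun w => \sum_(x : table T) \sum_(s : T.-tuple 'I_K)
                 table_lik w x * traj_weight pi x s * F w x s).

Definition BIC (T : nat) (pi : policy) : Prop :=
  forall (t : 'I_T) (i j : 'I_K),
    0 < Erun (T:=T) pi (fun _ _ s => ind (tnth s t == i)) ->
    0 <= Erun (T:=T) pi (fun w _ s => (mu i w - mu j w) * ind (tnth s t == i))
         / Erun (T:=T) pi (fun _ _ s => ind (tnth s t == i)).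

Definition collects (T : nat) (pi : policy) (N : nat) : Prop :=
  Erun (T:=T) pi (fun _ _ s => ind [forall i : 'I_K, (N <= count_mem i s)%N]) = 1.

End IncExp.

(* Main.v *)
(** Rounds are grouped into blocks of [2N] rounds with a constant arm.  Arm [j] is
    explored in a phase of [Q] blocks that starts once all arms [i < j] have been
    played.  The first block plays [j] exactly when the first [N_boot] samples of
    all lower arms vanish, which is incentive compatible by the choice of
    [N_boot]; otherwise a fixed lower arm [g] is played.  Write [U] for the event
    that [j] has been played in the phase.  Given the means, [Pr[U]] equals
    [V = q + (1 - q) Z], where [Z] is the conditional probability of those zeros
    and [q] is a deterministic schedule.  On [U], a test based on samples
    [N, .., 2N - 1] of the arms [i <= j] recommends [j] with a surplus of order
    [G_pad * E V] against each [i < j]; this surplus pays for the growth of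
    [q + p_boot] by a factor [1 + G_pad / 4], at the expense of the complement of [U].  Hence
    [O(G_pad^-1 log(1 / p_boot))] blocks suffice for [U] to become certain.

    The surplus [E[(mu_j - mu_q)_+ V] >= G_pad E V] is Harris' inequality: [Z] and
    [(mu_j - mu_q)_+] are both decreasing in the means of the lower arms.  One
    test works against all [i < j] simultaneously by Blackwell approachability
    (a minimax argument), mixing Bayes tests; a Bayes test has a threshold form
    in the samples of [j], which makes it favourable to [j] against the arms
    above [j] as well. *)

(* Given the means, the law of a block is built from two independent quantities: the zeros, read
   from the first [N] samples of each arm, and the test, read from the next [N]. For this reason the
   test ignores the first batch, a block has [2 N] rounds, and the exploration rate off [U] is
   deterministic: if [U] involved the test samples, [V] would not factor out. Incentive
   compatibility then splits into one inequality per piece of this law. Arms above [j] may be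
   unobserved, so against them only the prior order and independence are available.

   Constants: [N >= 16 * G_pad ^- 2] makes the mean estimation error at most [G_pad / 8]. Comparing
   two estimates costs [G_pad / 4], approachability costs another [G_pad / 4], and [G_pad / 2]
   remains. A schedule of rate [lam] consumes [2 * lam], whence [lam = G_pad / 4].

   Independence of the means is given for events. Factorization and Harris' inequality are proved
   for product weights on finite grids and carried over by Lipschitz approximation. *)
Require Import Defs.
From HB Require Import structures.
From mathcomp Require Import all_boot all_order all_algebra.
From mathcomp Require Import all_classical all_reals all_analysis.
From mathcomp Require Import measurable_realfun ring lra.
Set Implicit Arguments. Unset Strict Implicit. Unset Printing Implicit Defensive.
Import Order.TTheory GRing.Theory Num.Theory.
Import numFieldNormedType.Exports.
Local Open Scope classical_set_scope.
Local Open Scope ring_scope.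

(** * Finite product weights *)

Section ProductWeights.
Context {I V : finType} {R : realFieldType}.
Implicit Types (c : {ffun I -> V}) (p : I -> V -> R).

Definition upd c k b : {ffun I -> V} := [ffun i => if i == k then b else c i].

Lemma upd_same c k b : upd c k b k = b.
Proof. by rewrite ffunE eqxx. Qed.

Lemma upd_other c k b i : i != k -> upd c k b i = c i.
Proof. by move=> /negPf ik; rewrite ffunE ik. Qed.

Lemma upd_upd c k b b' : upd (upd c k b) k b' = upd c k b'.
Proof. by apply/ffunP => i; rewrite !ffunE; case: eqP. Qed.

Lemma upd_id c k : upd c k (c k) = c.
Proof. by apply/ffunP => i; rewrite ffunE; case: eqP => [->|]. Qed.

(** Exchanging [c k] with [b] is an involution of the pairs [(c, b)]. *)
Lemma sum_upd k (F : {ffun I -> V} -> V -> R) :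
  \sum_c \sum_b F c b = \sum_c \sum_b F (upd c k b) (c k).
Proof.
rewrite !pair_bigA /=.
rewrite (reindex_inj (h := fun u : {ffun I -> V} * V => (upd u.1 k u.2, u.1 k))) //=.
apply: (can_inj (g := fun u : {ffun I -> V} * V => (upd u.1 k u.2, u.1 k))).
by move=> [c b] /=; rewrite upd_upd upd_same upd_id.
Qed.

(** Summing the hypothesis over all [c] counts every configuration [#|V|] times. If [V] is empty
    there is no configuration, since [c k] would be an element of it. *)
Lemma sum_ge0_coord k (F : {ffun I -> V} -> R) :
  (forall c, 0 <= \sum_b F (upd c k b)) -> 0 <= \sum_c F c.
Proof.
move=> F0; have := sumr_ge0 (P := xpredT) (index_enum _) (fun c _ => F0 c).
rewrite -(sum_upd k (fun c _ => F c)).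
under eq_bigr do rewrite sumr_const.
rewrite sumrMnl; have [V0|V0] := posnP #|V|; last by rewrite pmulrn_lge0.
rewrite V0 => _; rewrite big1 // => c _.
by have /eqP := V0; rewrite -leqn0 leqNgt => /negP[]; apply/card_gt0P; exists (c k).
Qed.

Definition prodw p c : R := \prod_i p i (c i).

Lemma prodw_ge0 p c : (forall i b, 0 <= p i b) -> 0 <= prodw p c.
Proof. by move=> p0; apply: prodr_ge0. Qed.

(** Cross-multiplied because [p k (c k)] may vanish. *)
Lemma prodw_upd p c k b : prodw p (upd c k b) * p k (c k) = prodw p c * p k b.
Proof.
rewrite /prodw (bigD1 k) //= [in RHS](bigD1 k) //= upd_same.
rewrite (eq_bigr (fun i => p i (c i))); first by ring.
by move=> i ik; rewrite upd_other.
Qed.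

Lemma prodw_sum1 p : (forall i, \sum_b p i b = 1) -> \sum_c prodw p c = 1.
Proof. by move=> p1; rewrite -bigA_distr_bigA big1. Qed.

Lemma prodw_coord p k (F : {ffun I -> V} -> R) : \sum_b p k b = 1 ->
  \sum_c prodw p c * F c = \sum_c prodw p c * \sum_b p k b * F (upd c k b).
Proof.
move=> p1; transitivity (\sum_c \sum_b prodw p (upd c k b) * p k (c k) * F (upd c k b)).
  rewrite -(sum_upd k (fun c b => prodw p c * p k b * F c)).
  apply: eq_bigr => c _; under eq_bigr do rewrite mulrAC.
  by rewrite -mulr_sumr p1 mulr1.
apply: eq_bigr => c _; rewrite mulr_sumr; apply: eq_bigr => b _.
by rewrite prodw_upd mulrA.
Qed.

Lemma prodw_factor p k (f : V -> R) (g : {ffun I -> V} -> R) :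
  (forall i, \sum_b p i b = 1) -> (forall c b, g (upd c k b) = g c) ->
  \sum_c prodw p c * (f (c k) * g c) =
  (\sum_c prodw p c * f (c k)) * (\sum_c prodw p c * g c).
Proof.
move=> p1 gk; rewrite (@prodw_coord p k) // (@prodw_coord p k (fun c => f (c k))) //.
rewrite [X in _ = X * _](_ : _ = \sum_b p k b * f b); last first.
  under eq_bigr do under eq_bigr do rewrite upd_same.
  by rewrite -mulr_suml prodw_sum1 // mul1r.
rewrite mulr_sumr; apply: eq_bigr => c _.
under eq_bigr do rewrite upd_same gk mulrA.
by rewrite -mulr_suml; ring.
Qed.

(** Twice the difference of the two sides is the double sum of
    [w b * w b' * (f b - f b') * (h b - h b')]. *)
Lemma chebyshev_sum (w f h : V -> R) : (forall b, 0 <= w b) -> \sum_b w b = 1 ->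
  (forall b b', 0 <= (f b - f b') * (h b - h b')) ->
  (\sum_b w b * f b) * (\sum_b w b * h b) <= \sum_b w b * (f b * h b).
Proof.
move=> w0 w1 fh; rewrite -subr_ge0 -(pmulr_lge0 _ (ltr0n R 2)).
rewrite [X in 0 <= X](_ : _ = \sum_b \sum_b' w b * w b' * ((f b - f b') * (h b - h b'))).
  apply: sumr_ge0 => b _; apply: sumr_ge0 => b' _.
  by apply: mulr_ge0; [exact: mulr_ge0 | exact: fh].
have E : \sum_b w b * (f b * h b) = \sum_b \sum_b' w b * w b' * (f b * h b).
  apply: eq_bigr => b _; under eq_bigr do rewrite mulrAC mulrC.
  by rewrite -mulr_suml w1 mul1r.
have E' : \sum_b w b * (f b * h b) = \sum_b \sum_b' w b * w b' * (f b' * h b').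
  by rewrite E exchange_big /=; apply: eq_bigr => b _; apply: eq_bigr => b' _; ring.
have H : (\sum_b w b * f b) * (\sum_b w b * h b) = \sum_b \sum_b' w b * w b' * (f b * h b').
  rewrite big_distrlr /=; apply: eq_bigr => b _; apply: eq_bigr => b' _; ring.
have H' : (\sum_b w b * f b) * (\sum_b w b * h b) = \sum_b \sum_b' w b * w b' * (f b' * h b).
  by rewrite H exchange_big /=; apply: eq_bigr => b _; apply: eq_bigr => b' _; ring.
rewrite (_ : (_ - _) * 2%:R = \sum_b w b * (f b * h b) + \sum_b w b * (f b * h b)
  - (\sum_b w b * f b) * (\sum_b w b * h b) - (\sum_b w b * f b) * (\sum_b w b * h b)); last by ring.
rewrite {1}E E' {1}H H' -big_split -!sumrB /=.
apply: eq_bigr => b _; rewrite -big_split -!sumrB /=.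
apply: eq_bigr => b' _; ring.
Qed.

(* Harris' inequality, by Chebyshev's sum inequality in one coordinate at a time. *)
Lemma prodw_harris p (f : {ffun I -> V} -> R) (h : I -> V -> R) (r : seq I) :
  uniq r -> (forall i b, 0 <= p i b) -> (forall i, \sum_b p i b = 1) ->
  (forall i b, 0 <= h i b) ->
  (forall k c b, k \in r -> 0 <= (f c - f (upd c k b)) * (h k (c k) - h k b)) ->
  (\sum_c prodw p c * f c) * (\sum_c prodw p c * \prod_(i <- r) h i (c i)) <=
  \sum_c prodw p c * (f c * \prod_(i <- r) h i (c i)).
Proof.
move=> + p0 p1 h0; elim: r => [_ _|k r IH /= /andP[kr ur] fh].
  under [X in _ * X]eq_bigr do rewrite big_nil mulr1.
  by under [leRHS]eq_bigr do rewrite big_nil mulr1; rewrite prodw_sum1 // mulr1.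
have upd_r c b : \prod_(i <- r) h i (upd c k b i) = \prod_(i <- r) h i (c i).
  rewrite !big_seq; apply: eq_bigr => i ir; rewrite upd_other //.
  by apply: contraNneq kr => <-.
set g := fun c : {ffun I -> V} => \prod_(i <- r) h i (c i).
under [X in _ * X]eq_bigr do rewrite big_cons.
rewrite (@prodw_factor p k (h k) g) //.
have step : (\sum_c prodw p c * h k (c k)) * (\sum_c prodw p c * (f c * g c)) <=
    \sum_c prodw p c * (f c * \prod_(i <- k :: r) h i (c i)).
  rewrite [leRHS](@prodw_coord p k) // (@prodw_coord p k (fun c => h k (c k))) //.
  rewrite [X in X * _ <= _](_ : _ = \sum_b p k b * h k b); last first.
    under eq_bigr do under eq_bigr do rewrite upd_same.
    by rewrite -mulr_suml prodw_sum1 // mul1r.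
  rewrite (@prodw_coord p k (fun c => f c * g c)) // mulr_sumr.
  apply: ler_sum => c _; rewrite mulrCA; apply: ler_wpM2l; first exact: prodw_ge0.
  under [leRHS]eq_bigr do rewrite big_cons upd_same upd_r.
  under [X in _ * X <= _]eq_bigr do rewrite (upd_r _ _ : g (upd _ _ _) = g _) mulrA.
  rewrite -mulr_suml mulrA.
  rewrite [leRHS](_ : _ = (\sum_b p k b * (f (upd c k b) * h k b)) * g c); last first.
    rewrite mulr_suml; apply: eq_bigr => b _; rewrite /g; ring.
  apply: ler_wpM2r; first exact: prodr_ge0.
  rewrite mulrC; apply: chebyshev_sum => // b b'.
  have := fh k (upd c k b) b'; rewrite upd_upd upd_same; apply.
  by rewrite in_cons eqxx.
apply: le_trans step; rewrite mulrCA; apply: ler_wpM2l.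
  by apply: sumr_ge0 => c _; rewrite mulr_ge0 // prodw_ge0.
apply: IH => // i c b ir; apply: fh; by rewrite in_cons ir orbT.
Qed.

End ProductWeights.

Section ProductMarginal.
Context {I V : finType} {R : realFieldType}.

Lemma prodw_marginal (p : I -> V -> R) k (f : V -> R) : (forall i, \sum_b p i b = 1) ->
  \sum_(c : {ffun I -> V}) prodw p c * f (c k) = \sum_b p k b * f b.
Proof.
move=> p1; rewrite (@prodw_coord _ _ _ p k (fun c => f (c k))) //.
under eq_bigr do under eq_bigr do rewrite upd_same.
by rewrite -mulr_suml prodw_sum1 // mul1r.
Qed.

(* Selecting the outcomes of large ratio [M b / L b] raises the mean of [M]. *)
Lemma threshold_sum_ge0 (M L : V -> R) (m A B : R) :
  (forall b, 0 <= L b) -> 0 <= A -> \sum_b M b = m -> \sum_b L b = 1 ->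
  0 <= \sum_b (M b - m * L b) * A * (0 < M b * A - L b * B)%R%:R.
Proof.
move=> L0 A0 Mm L1; have [AB|AB] := leP (m * A) B.
  apply: sumr_ge0 => b _; have := L0 b; case: ltP => h Lb; rewrite ?mulr0 // mulr1; nra.
(* Here [B < m * A]: the unselected outcomes contribute nonpositive terms, and the sum over all
   outcomes is 0. *)
have E : \sum_b (M b - m * L b) * A = 0.
  by rewrite -mulr_suml sumrB -mulr_sumr Mm L1 mulr1 subrr mul0r.
rewrite -oppr_le0 -[X in X <= _]add0r -{1}E -sumrB; apply: sumr_le0 => b _.
by have := L0 b; case: ltP => h Lb; rewrite ?mulr1 ?subrr // mulr0 subr0; nra.
Qed.

End ProductMarginal.

(** * Blackwell approachability for finitely many payoffs *)

Section Approachability.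
Context {I : finType} {R : archiRealFieldType} {S : Type}.
Variables (A : pred I) (v : S -> I -> R) (lam : R).

(* Blackwell's argument: answering the direction of the current positive
   deficits keeps their squared norm linear in the number of steps. *)
Lemma approachability (i0 : I) (eps : R) : A i0 -> `|lam| <= 1 ->
  (forall s i, `|v s i| <= 1) ->
  (forall q : I -> R, (forall i, 0 <= q i) -> (forall i, ~~ A i -> q i = 0) ->
    \sum_i q i = 1 -> exists s, lam <= \sum_i q i * v s i) ->
  0 < eps ->
  exists l : seq S, (0 < size l)%N /\
    forall i, A i -> (lam - eps) * (size l)%:R <= \sum_(s <- l) v s i.
Proof.
move=> Ai0 lam1 v1 resp eps0.
pose dd (l : seq S) i := \sum_(s <- l) (lam - v s i).
pose p l i := if A i then Num.max (dd l i) 0 else 0.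
have p_ge0 l i : 0 <= p l i by rewrite /p; case: ifP => // _; rewrite le_max lexx orbT.
(* Respond to the normalised deficits. Without a positive deficit any response works, and the
   direction [i0] only serves to produce one. *)
have step l : exists s, \sum_i p l i * (lam - v s i) <= 0.
  have [p0|p0] := eqVneq (\sum_i p l i) 0.
    have [s _] : exists s, lam <= \sum_i (i == i0)%:R * v s i.
      apply: resp => [i|i Ai|]; first exact: ler0n.
        by case: eqP => // ii0; rewrite ii0 Ai0 in Ai.
      by rewrite (bigD1 i0) //= eqxx big1 ?addr0 // => i /negPf ->.
    exists s; rewrite big1 // => i _.
    by move/eqP: p0; rewrite psumr_eq0 // => /allP/(_ i (mem_index_enum _))/eqP->; rewrite mul0r.
  have pp : 0 < \sum_i p l i by rewrite lt_neqAle eq_sym p0 sumr_ge0.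
  have [s Hs] : exists s, lam <= \sum_i p l i / (\sum_i p l i) * v s i.
    apply: resp => [i|i /negPf Ai|]; first by rewrite divr_ge0 // ltW.
      by rewrite /p Ai mul0r.
    by rewrite -mulr_suml divff.
  exists s; under eq_bigr do rewrite mulrBr.
  rewrite sumrB -mulr_suml subr_le0 mulrC -ler_pdivlMr //.
  rewrite mulr_suml; apply: le_trans Hs _; apply: ler_sum => i _.
  by rewrite mulrAC.
have bound n : exists l, size l = n /\ \sum_i p l i ^+ 2 <= 4 * #|I|%:R * n%:R.
  elim: n => [|n [l [szl Hl]]].
    exists [::]; split => //; rewrite mulr0 big1 // => i _.
    by rewrite /p /dd big_nil maxxx; case: ifP; rewrite expr0n.
  have [s Hs] := step l; exists (s :: l); split; first by rewrite /= szl.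
  (* The positive part of [d + x] has square at most that of [d] plus [2 * max d 0 * x + x ^+ 2].
     The cross terms sum to a nonpositive number by the choice of [s]. *)
  have E i : p (s :: l) i ^+ 2 <= p l i ^+ 2 + 2 * (p l i * (lam - v s i)) + 4.
    have x2 : (lam - v s i) ^+ 2 <= 4.
      have := v1 s i; move: lam1; rewrite !ler_norml; nra.
    rewrite /p; case: ifP => _; last by rewrite expr0n /=; lra.
    rewrite /dd big_cons -/(dd l i); move: (dd l i) (lam - v s i) x2 => d x x2.
    by case: (leP (x + d) 0) => ?; case: (leP d 0) => ?; nra.
  apply: le_trans (ler_sum _ (fun i _ => E i)) _.
  rewrite !big_split /= -mulr_sumr sumr_const -[n.+1%:R]natr1 mulrDr mulr1.
  rewrite -mulr_natr; lra.
(* Beyond [4 * #|I| / eps ^+ 2] steps, a deficit above [eps * n] would have too large a square. *)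
have /Num.Theory.archi_boundP := divr_ge0 (mulr_ge0 (ler0n R 4) (ler0n R #|I|)) (exprn_ge0 2 (ltW eps0)).
set n := Num.bound _ => Hn; have [l [szl Hl]] := bound n.+1.
exists l; rewrite szl; split => // i Ai.
have d_le : dd l i <= eps * n.+1%:R.
  rewrite leNgt; apply/negP => lt_d.
  have : p l i ^+ 2 <= 4 * #|I|%:R * n.+1%:R.
    apply: le_trans Hl; rewrite (bigD1 i) //= lerDl sumr_ge0 // => k _.
    exact: sqr_ge0.
  have n0 : 0 < n.+1%:R :> R by rewrite ltr0n.
  have -> : p l i = dd l i.
    rewrite /p Ai max_l //; apply: le_trans (ltW lt_d).
    by apply: mulr_ge0 => //; exact: ltW.
  apply/negP; rewrite -ltNge.
  apply: (@lt_le_trans _ _ ((eps * n.+1%:R) ^+ 2)); last first.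
    by rewrite ler_pXn2r // ?nnegrE ?mulr_ge0 // ?ltW // (le_lt_trans _ lt_d) // mulr_ge0 // ltW.
  rewrite exprMn [n.+1%:R ^+ 2]expr2 mulrA ltr_pM2r //.
  rewrite [eps ^+ 2 * _]mulrC -ltr_pdivrMr ?exprn_gt0 //; apply: lt_trans Hn _.
  by rewrite ltr_nat.
move: d_le; rewrite /dd sumrB big_const_seq count_predT szl.
rewrite iter_addr_0 -mulr_natr; lra.
Qed.

End Approachability.

(** * Expectations of Lipschitz functions of the means *)

Section BoundedExpectation.
Context {d : measure_display} {Omega : measurableType d} {R : realType}.
Variable (P : probability Omega R).
Implicit Types f g : Omega -> R.

Definition bmeas f := measurable_fun setT f /\ exists M, forall w, `|f w| <= M.

Lemma bmeas_integrable f : bmeas f -> P.-integrable setT (EFin \o f).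
Proof.
move=> [mf [M fM]]; apply: measurable_bounded_integrable => //.
  exact: le_lt_trans (probability_le1 P measurableT) (ltry _).
exists M; split => [|x Mx w _]; first exact: num_real.
by apply: le_trans (fM w) _; exact: ltW.
Qed.

Lemma ExD f g : bmeas f -> bmeas g -> Ex P (fun w => f w + g w) = Ex P f + Ex P g.
Proof. by move=> /bmeas_integrable ? /bmeas_integrable ?; exact: RintegralD. Qed.

Lemma ExZ c f : bmeas f -> Ex P (fun w => c * f w) = c * Ex P f.
Proof. by move=> /bmeas_integrable ?; exact: RintegralZl. Qed.

Lemma Ex_cst c : Ex P (fun _ => c) = c.
Proof.
rewrite /Ex (Rintegral_cst P measurableT) -[RHS]mulr1; congr (_ * _).
exact: (congr1 fine (probability_setT P)).
Qed.

Lemma Ex_le f g : bmeas f -> bmeas g -> (forall w, f w <= g w) -> Ex P f <= Ex P g.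
Proof. by move=> /bmeas_integrable ? /bmeas_integrable ? fg; apply: le_Rintegral. Qed.

Lemma Ex_ext f g : (forall w, f w = g w) -> Ex P f = Ex P g.
Proof. by move=> fg; congr Ex; apply/funext. Qed.

Lemma Ex_indic (D : set Omega) : measurable D -> Ex P (\1_D) = fine (P D).
Proof. by move=> mD; rewrite /Ex /Rintegral integral_indic // setIT. Qed.

Lemma bmeas_cst c : bmeas (fun _ => c).
Proof. by split => //; exists `|c|. Qed.

Lemma bmeasD f g : bmeas f -> bmeas g -> bmeas (fun w => f w + g w).
Proof.
move=> [mf [M fM]] [mg [N gN]]; split; first exact: measurable_funD.
by exists (M + N) => w; apply: le_trans (ler_normD _ _) _; rewrite lerD.
Qed.

Lemma bmeasM f g : bmeas f -> bmeas g -> bmeas (fun w => f w * g w).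
Proof.
move=> [mf [M fM]] [mg [N gN]]; split; first exact: measurable_funM.
by exists (M * N) => w; rewrite normrM ler_pM.
Qed.

Lemma bmeas_indic (D : set Omega) : measurable D -> bmeas (\1_D).
Proof.
move=> mD; split; first exact: measurable_indic.
by exists 1 => w; rewrite indicE; case: (_ \in _); rewrite ?normr1 ?normr0.
Qed.

Lemma bmeas_sum (I : Type) (r : seq I) (F : I -> Omega -> R) :
  (forall i, bmeas (F i)) -> bmeas (fun w => \sum_(i <- r) F i w).
Proof.
move=> bF; elim: r => [|i r IH].
  by under [X in bmeas X]funext do rewrite big_nil; exact: bmeas_cst.
by under [X in bmeas X]funext do rewrite big_cons; exact: bmeasD.
Qed.

Lemma Ex_sum (I : Type) (r : seq I) (F : I -> Omega -> R) :
  (forall i, bmeas (F i)) ->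
  Ex P (fun w => \sum_(i <- r) F i w) = \sum_(i <- r) Ex P (F i).
Proof.
move=> bF; elim: r => [|i r IH].
  by rewrite big_nil -[RHS](Ex_cst 0); apply: Ex_ext => w; rewrite big_nil.
rewrite big_cons -IH -ExD //; last exact: bmeas_sum.
by apply: Ex_ext => w; rewrite big_cons.
Qed.

Lemma Ex_dist f g B : bmeas f -> bmeas g -> (forall w, `|f w - g w| <= B) ->
  `|Ex P f - Ex P g| <= B.
Proof.
move=> bf bg fgB.
have shift u : bmeas u -> Ex P (fun w => u w + B) = Ex P u + B.
  by move=> bu; rewrite ExD ?Ex_cst //; exact: bmeas_cst.
have f_le : Ex P f <= Ex P (fun w => g w + B).
  apply: Ex_le => // [|w]; first by apply: bmeasD => //; exact: bmeas_cst.
  by have := fgB w; rewrite ler_norml; lra.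
have g_le : Ex P g <= Ex P (fun w => f w + B).
  apply: Ex_le => // [|w]; first by apply: bmeasD => //; exact: bmeas_cst.
  by have := fgB w; rewrite ler_norml; lra.
move: f_le g_le; rewrite !shift // ler_norml; lra.
Qed.

End BoundedExpectation.

Section NiceFunctions.
Context {d : measure_display} {Omega : measurableType d} {R : realType}.
Variable (P : probability Omega R).
Context {K : nat}.
Variable (mu : 'I_K -> Omega -> R).
Hypothesis mu_meas : forall i, measurable_fun setT (mu i).
Hypothesis mu01 : forall i w, 0 <= mu i w <= 1.
Implicit Types (F G : ('I_K -> R) -> R) (a b : 'I_K -> R).

Definition cube a := forall i, 0 <= a i <= 1.

(* Regular enough for [EE] to be a limit of expectations over finite grids, where
   independence is a statement about finite sums. *)
Definition nice F := measurable_fun setT (fun w => F (mu ^~ w)) /\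
  exists L, forall a b, cube a -> cube b -> `|F a - F b| <= L * \sum_i `|a i - b i|.

Definition EE F := Ex P (fun w => F (mu ^~ w)).

Lemma cube_mu w : cube (mu ^~ w).
Proof. by move=> i; exact: mu01. Qed.

Lemma nice_bounded F : nice F -> exists2 M, 0 <= M & forall a, cube a -> `|F a| <= M.
Proof.
move=> [_ [L FL]]; pose z := (fun _ => 0) : 'I_K -> R.
have cz : cube z by move=> i; rewrite /z lexx ler01.
have FaM a : cube a -> `|F a| <= `|F z| + `|L| * K%:R.
  move=> ca; rewrite -[F a](subrK (F z)) addrC; apply: le_trans (ler_normD _ _) _.
  rewrite lerD2l; apply: le_trans (FL _ _ ca cz) _.
  apply: le_trans (ler_wpM2r _ (ler_norm L)) _; first exact: sumr_ge0.
  apply: ler_wpM2l => //; have -> : K%:R = \sum_(i < K) 1 :> R by rewrite sumr_const card_ord.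
  apply: ler_sum => i _.
  by rewrite /z subr0 ger0_norm; case/andP: (ca i).
by exists (`|F z| + `|L| * K%:R) => //; rewrite addr_ge0 // mulr_ge0.
Qed.

Lemma nice_bmeas F : nice F -> bmeas (fun w => F (mu ^~ w)).
Proof.
move=> nF; split; first by case: nF.
by have [M _ FM] := nice_bounded nF; exists M => w; apply/FM/cube_mu.
Qed.
Hint Resolve nice_bmeas : core.

Lemma nice_ge0 F : nice F -> exists2 L, 0 <= L &
  forall a b, cube a -> cube b -> `|F a - F b| <= L * \sum_i `|a i - b i|.
Proof.
move=> [_ [L FL]]; exists `|L| => // a b ca cb; apply: le_trans (FL _ _ ca cb) _.
by apply: ler_wpM2r; [exact: sumr_ge0 | exact: ler_norm].
Qed.

Lemma nice_cst c : nice (fun _ => c).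
Proof.
by split => //; exists 0 => a b _ _; rewrite subrr normr0 mul0r.
Qed.

Lemma nice_coord i : nice (fun a => a i).
Proof.
split => //; exists 1 => a b _ _; rewrite mul1r (bigD1 i) //= lerDl.
exact: sumr_ge0.
Qed.

Lemma niceD F G : nice F -> nice G -> nice (fun a => F a + G a).
Proof.
move=> [mF [L FL]] [mG [M GM]]; split; first exact: measurable_funD.
exists (L + M) => a b ca cb; rewrite mulrDl opprD addrACA.
apply: le_trans (ler_normD _ _) _; apply: lerD; [exact: FL | exact: GM].
Qed.

Lemma niceM F G : nice F -> nice G -> nice (fun a => F a * G a).
Proof.
move=> nF nG; have [L L0 FL] := nice_ge0 nF; have [M M0 GM] := nice_ge0 nG.
have [B B0 FB] := nice_bounded nF; have [C C0 GC] := nice_bounded nG.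
split; first by apply: measurable_funM; [case: nF | case: nG].
exists (L * C + B * M) => a b ca cb.
rewrite (_ : _ - _ = (F a - F b) * G a + F b * (G a - G b)); last by ring.
apply: le_trans (ler_normD _ _) _; rewrite !normrM mulrDl; apply: lerD.
  by rewrite mulrAC; apply: ler_pM => //; [exact: FL | exact: GC].
by rewrite -mulrA; apply: ler_pM => //; [exact: FB | exact: GM].
Qed.

Lemma niceZ c F : nice F -> nice (fun a => c * F a).
Proof. by apply: niceM; exact: nice_cst. Qed.

Lemma niceN F : nice F -> nice (fun a => - F a).
Proof.
move=> nF; rewrite (_ : (fun a => _) = fun a => -1 * F a); first exact: niceZ.
by apply/funext => a; rewrite mulN1r.
Qed.

Lemma niceB F G : nice F -> nice G -> nice (fun a => F a - G a).
Proof. by move=> nF nG; apply: niceD => //; exact: niceN. Qed.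

Lemma niceX F n : nice F -> nice (fun a => F a ^+ n).
Proof.
move=> nF; elim: n => [|n IH]; first by under [X in nice X]funext do rewrite expr0; exact: nice_cst.
by under [X in nice X]funext do rewrite exprS; exact: niceM.
Qed.

Lemma nice_sum (I : Type) (r : seq I) (Q : pred I) (F : I -> ('I_K -> R) -> R) :
  (forall i, nice (F i)) -> nice (fun a => \sum_(i <- r | Q i) F i a).
Proof.
move=> nF; elim: r => [|i r IH].
  by under [X in nice X]funext do rewrite big_nil; exact: nice_cst.
under [X in nice X]funext do rewrite big_cons.
by case: (Q i) => //; exact: niceD.
Qed.

Lemma nice_prod (I : Type) (r : seq I) (Q : pred I) (F : I -> ('I_K -> R) -> R) :
  (forall i, nice (F i)) -> nice (fun a => \prod_(i <- r | Q i) F i a).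
Proof.
move=> nF; elim: r => [|i r IH].
  by under [X in nice X]funext do rewrite big_nil; exact: nice_cst.
under [X in nice X]funext do rewrite big_cons.
by case: (Q i) => //; exact: niceM.
Qed.

Lemma nice_max0 F : nice F -> nice (fun a => Num.max (F a) 0).
Proof.
move=> [mF [L FL]]; split; first exact: measurable_maxr.
exists L => a b ca cb; apply: le_trans (FL _ _ ca cb).
move: (F a) (F b) => x y; rewrite ler_norml.
have := ler_norm (x - y); have := ler_norm (y - x); rewrite distrC.
by case: (leP x 0) => ?; case: (leP y 0) => ?; lra.
Qed.

Lemma EED F G : nice F -> nice G -> EE (fun a => F a + G a) = EE F + EE G.
Proof. by move=> nF nG; rewrite /EE -ExD; auto. Qed.

Lemma EEZ c F : nice F -> EE (fun a => c * F a) = c * EE F.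
Proof. by move=> nF; rewrite /EE -ExZ; auto. Qed.

Lemma EEN F : nice F -> EE (fun a => - F a) = - EE F.
Proof. by move=> nF; rewrite -mulN1r -EEZ //; congr EE; apply/funext => a; rewrite mulN1r. Qed.

Lemma EEB F G : nice F -> nice G -> EE (fun a => F a - G a) = EE F - EE G.
Proof. by move=> nF nG; rewrite EED ?EEN //; exact: niceN. Qed.

Lemma EE_cst c : EE (fun _ => c) = c.
Proof. exact: Ex_cst. Qed.

Lemma EE_sum (I : Type) (r : seq I) (F : I -> ('I_K -> R) -> R) :
  (forall i, nice (F i)) ->
  EE (fun a => \sum_(i <- r) F i a) = \sum_(i <- r) EE (F i).
Proof. by move=> nF; rewrite /EE (@Ex_sum _ _ _ P _ r (fun i w => F i (mu ^~ w))) //; auto. Qed.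

Lemma EE_le F G : nice F -> nice G -> (forall a, cube a -> F a <= G a) -> EE F <= EE G.
Proof. by move=> nF nG FG; apply: Ex_le; auto => w; apply/FG/cube_mu. Qed.

Lemma EE_ge0 F : nice F -> (forall a, cube a -> 0 <= F a) -> 0 <= EE F.
Proof. by move=> nF F0; rewrite -(EE_cst 0); apply: EE_le => //; exact: nice_cst. Qed.

Lemma EE_ext F G : (forall a, cube a -> F a = G a) -> EE F = EE G.
Proof. by move=> FG; apply: Ex_ext => w; apply/FG/cube_mu. Qed.

End NiceFunctions.

(** * Independence of the means, through finite grids *)

Section Independence.
Context {d : measure_display} {Omega : measurableType d} {R : realType}.
Variable (P : probability Omega R).
Context {K : nat}.
Variable (mu : 'I_K -> Omega -> R).
Hypothesis mu_meas : forall i, measurable_fun setT (mu i).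
Hypothesis mu01 : forall i w, 0 <= mu i w <= 1.
Hypothesis mu_indep : indep_means P mu.
Implicit Types (F G : ('I_K -> R) -> R) (a b : 'I_K -> R).
Local Notation nice := (nice mu).
Local Notation EE := (EE P mu).

(** The last index [m.+1] is there for the value 1, which starts its own half-open cell. *)
Definition grid_cell m (c : 'I_m.+2) : set R := `[c%:R / m.+1%:R, c.+1%:R / m.+1%:R[.

Definition grid_weight m (i : 'I_K) (c : 'I_m.+2) : R := fine (P (mu i @^-1` grid_cell c)).

Definition grid_point m (c : {ffun 'I_K -> 'I_m.+2}) : 'I_K -> R :=
  fun i => (c i)%:R / m.+1%:R.

Definition grid_index m (t : R) : 'I_m.+2 := inord (Num.truncn (t * m.+1%:R)).

Definition gridE m F : R :=
  \sum_c prodw (@grid_weight m) c * F (grid_point c).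

Lemma grid_index_itv m t : 0 <= t <= 1 ->
  (grid_index m t)%:R <= t * m.+1%:R < (grid_index m t).+1%:R.
Proof.
move=> /andP[t0 t1]; have tm : 0 <= t * m.+1%:R by apply: mulr_ge0.
rewrite /grid_index inordK ?truncn_itv // ltnS -(ler_nat R).
apply: le_trans (_ : t * m.+1%:R <= _); first by rewrite truncn_le.
by rewrite -[leRHS]mul1r ler_wpM2r.
Qed.

Lemma grid_cellE m t (c : 'I_m.+2) : 0 <= t <= 1 -> grid_cell c t <-> grid_index m t = c.
Proof.
move=> t01; have /andP[t0 _] := t01.
rewrite /grid_cell /= in_itv /= ler_pdivrMr // ltr_pdivlMr //; split.
  move=> h; apply: val_inj => /=; have := h.
  rewrite -truncn_eq; last exact: mulr_ge0.
  by move=> /eqP; rewrite /grid_index => ->; rewrite inordK.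
by move=> <-; exact: grid_index_itv.
Qed.

Lemma grid_point_cube m c : cube (@grid_point m c).
Proof.
move=> i; rewrite /grid_point divr_ge0 //= ler_pdivrMr // mul1r ler_nat.
by rewrite -ltnS.
Qed.

Lemma grid_weight_ge0 m i c : 0 <= @grid_weight m i c.
Proof. exact: fine_ge0. Qed.

Lemma measurable_grid m i (c : 'I_m.+2) : measurable (mu i @^-1` grid_cell c).
Proof. by rewrite -[_ @^-1` _]setTI; apply: mu_meas => //; exact: measurable_itv. Qed.

Lemma grid_weight_sum1 m i : \sum_c @grid_weight m i c = 1.
Proof.
rewrite (eq_bigr (fun c : 'I_m.+2 => Ex P (\1_(mu i @^-1` grid_cell c)))); last first.
  by move=> c _; rewrite Ex_indic //; exact: measurable_grid.
rewrite -Ex_sum; last by move=> c; apply/bmeas_indic/measurable_grid.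
rewrite -[RHS](Ex_cst P 1); apply: Ex_ext => w.
rewrite (bigD1 (grid_index m (mu i w))) //= big1.
  by rewrite addr0 indicE mem_set //; exact/grid_cellE.
by move=> c /negP cw; rewrite indicE memNset // => /(grid_cellE _ (mu01 i w)) E; apply: cw; apply/eqP.
Qed.

(** Rounding the means down to the grid moves each coordinate by at most [harmonic m]. By
    independence the rounded means have the product law [prodw grid_weight]. *)
Lemma grid_approx F : nice F ->
  exists L, forall m, `|EE F - gridE m F| <= L * harmonic m.
Proof.
move=> nF; have [L L0 FL] := nice_ge0 nF; exists (L * K%:R) => m.
pose A (c : {ffun 'I_K -> 'I_m.+2}) := [set w | forall i, grid_cell (c i) (mu i w)].
have AE c : A c = \bigcap_(i in [set: 'I_K]) (mu i @^-1` grid_cell (c i)).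
  by apply/seteqP; split => w Aw i; [move=> _; exact: Aw | exact: (Aw i)].
have mA c : measurable (A c).
  rewrite AE; apply: fin_bigcap_measurable => // i _; exact: measurable_grid.
have PA c : fine (P (A c)) = prodw (@grid_weight m) c.
  have := mu_indep (fun i => measurable_itv `[(c i)%:R / m.+1%:R, (c i).+1%:R / m.+1%:R[).
  by rewrite /A => ->.
pose g w := \sum_c \1_(A c) w * F (grid_point c).
have bg : bmeas g.
  apply: bmeas_sum => c; apply: bmeasM; [exact: bmeas_indic | exact: bmeas_cst].
have -> : gridE m F = Ex P g.
  rewrite /g Ex_sum; last first.
    by move=> c; apply: bmeasM; [exact: bmeas_indic | exact: bmeas_cst].
  apply: eq_bigr => c _; rewrite -PA -Ex_indic // mulrC -ExZ; last exact: bmeas_indic.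
  by apply: Ex_ext => w; rewrite mulrC.
have close w : `|F (mu ^~ w) - g w| <= L * K%:R * harmonic m.
  have -> : g w = F (grid_point [ffun i => grid_index m (mu i w)]).
    rewrite /g (bigD1 [ffun i => grid_index m (mu i w)]) //= big1.
      by rewrite addr0 indicE mem_set ?mul1r // => i; apply/grid_cellE => //; rewrite ffunE.
    move=> c /negP cw; rewrite indicE memNset ?mul0r // => Acw; apply: cw; apply/eqP/ffunP => i.
    by rewrite ffunE; symmetry; apply/grid_cellE.
  apply: le_trans (FL _ _ (cube_mu mu01 w) (grid_point_cube _)) _.
  rewrite -mulrA; apply: ler_wpM2l => //.
  rewrite mulr_natl -[X in _ *+ X]card_ord -sumr_const; apply: ler_sum => i _.
  rewrite /grid_point ffunE /harmonic /=; have /andP[h1 h2] := grid_index_itv m (mu01 i w).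
  have m0 : 0 < m.+1%:R :> R by [].
  rewrite ger0_norm ?subr_ge0 ?ler_pdivrMr // lerBlDl -[X in _ + X]mul1r -mulrDl natr1.
  by rewrite ler_pdivlMr // ltW.
have bF := nice_bmeas mu01 nF.
exact: Ex_dist.
Qed.

Lemma gridE_cvg F : nice F -> gridE ^~ F @ \oo --> EE F.
Proof.
move=> /grid_approx[L FL].
have h0 : (fun m => `|L| * harmonic m) @ \oo --> (0 : R).
  rewrite -[X in _ --> X](mulr0 `|L|); apply: cvgM; [exact: cvg_cst | exact: cvg_harmonic].
apply/cvgrPdist_le => e e0; move/cvgrPdist_le/(_ e e0): h0; apply: filterS => m.
rewrite sub0r normrN => h; apply: le_trans (FL m) _; apply: le_trans h.
rewrite ger0_norm; last by apply: mulr_ge0; rewrite // invr_ge0.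
by apply: ler_wpM2r; [rewrite invr_ge0 | exact: ler_norm].
Qed.

(** The identity is exact on every grid ([prodw_factor]) and passes to the limit. *)
Lemma EE_factor k F G : nice F -> nice G ->
  (forall a b, cube a -> cube b -> a k = b k -> F a = F b) ->
  (forall a b, cube a -> cube b -> (forall i, i != k -> a i = b i) -> G a = G b) ->
  EE (fun a => F a * G a) = EE F * EE G.
Proof.
move=> nF nG Fk Gk.
rewrite -(cvg_lim (@Rhausdorff R) (gridE_cvg (niceM nF nG))).
rewrite -(cvg_lim (@Rhausdorff R) (cvgM (gridE_cvg nF) (gridE_cvg nG))).
congr (lim (_ @ \oo)); apply/funext => m; rewrite /gridE /=.
pose f (b : 'I_m.+2) := F (grid_point [ffun => b]).
have Ff c : F (grid_point c) = f (c k).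
  by apply: Fk; [exact: grid_point_cube | exact: grid_point_cube | rewrite /grid_point ffunE].
under eq_bigr do rewrite Ff.
under [in RHS]eq_bigr do rewrite Ff.
apply: (@prodw_factor _ _ _ _ k f (fun c => G (grid_point c))).
  exact: grid_weight_sum1.
move=> c b; apply: Gk; [exact: grid_point_cube | exact: grid_point_cube |].
by move=> i ik; rewrite /grid_point upd_other.
Qed.

(** Limit of [prodw_harris] on grids. Monotonicity of [F] is asked only along [r]: the intended [F]
    decreases in the lower arms but increases in the mean of [j]. *)
Lemma EE_harris (r : seq 'I_K) (h : R -> R) F : uniq r -> nice F ->
  (forall i, nice (fun a => h (a i))) ->
  (forall t, 0 <= t <= 1 -> 0 <= h t) ->
  (forall s t, 0 <= s -> s <= t -> t <= 1 -> h t <= h s) ->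
  (forall k a b, cube a -> cube b -> k \in r -> (forall i, i != k -> a i = b i) ->
     a k <= b k -> F b <= F a) ->
  EE F * EE (fun a => \prod_(i <- r) h (a i)) <=
  EE (fun a => F a * \prod_(i <- r) h (a i)).
Proof.
move=> ur nF nh h0 h_anti F_anti.
have nH : nice (fun a => \prod_(i <- r) h (a i)) by apply: nice_prod.
have nFH := niceM nF nH.
apply: (ler_cvg_to (cvgM (gridE_cvg nF) (gridE_cvg nH)) (gridE_cvg nFH)).
apply: nearW => m; rewrite /gridE.
have t01 (b : 'I_m.+2) : 0 <= (b%:R / m.+1%:R : R) <= 1.
  rewrite divr_ge0 //= ler_pdivrMr // mul1r ler_nat -ltnS; exact: ltn_ord.
apply: (@prodw_harris _ _ _ _ (fun c => F (grid_point c))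
  (fun=> fun b : 'I_m.+2 => h (b%:R / m.+1%:R))) => //.
- exact: grid_weight_ge0.
- exact: grid_weight_sum1.
- by move=> _ b; apply/h0/t01.
- move=> k c b kr.
  have Fc (c1 c2 : {ffun 'I_K -> 'I_m.+2}) : (forall i, i != k -> c1 i = c2 i) -> (c1 k <= c2 k)%N ->
      F (grid_point c2) <= F (grid_point c1) /\
      h ((c2 k)%:R / m.+1%:R) <= h ((c1 k)%:R / m.+1%:R).
    move=> c12 lec; have lec' : (c1 k)%:R / m.+1%:R <= (c2 k)%:R / m.+1%:R :> R.
      by apply: ler_wpM2r; [rewrite invr_ge0 | rewrite ler_nat].
    split; last first.
      by case/andP: (t01 (c1 k)) => ? _; case/andP: (t01 (c2 k)) => _ ?; exact: h_anti.
    apply: (F_anti k) => //; [exact: grid_point_cube | exact: grid_point_cube |].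
    by move=> i /c12; rewrite /grid_point => ->.
  have off i : i != k -> upd c k b i = c i by exact: upd_other.
  have [le|/ltnW le] := leqP (c k) b.
    have [|F1 h1] := Fc c (upd c k b) (fun i ik => esym (off i ik)); first by rewrite upd_same.
    by rewrite upd_same in h1; rewrite mulr_ge0 // subr_ge0.
  have [|F1 h1] := Fc (upd c k b) c off; first by rewrite upd_same.
  by rewrite upd_same in h1; rewrite mulr_le0 // subr_le0.
Qed.

End Independence.

(** * The padded test *)

Section Padding.
Context {d : measure_display} {Omega : measurableType d} {R : realType}.
Variable (P : probability Omega R).
Context {K : nat}.
Variable (mu : 'I_K -> Omega -> R).
Hypothesis mu_meas : forall i, measurable_fun setT (mu i).
Hypothesis mu01 : forall i w, 0 <= mu i w <= 1.
Hypothesis mu_indep : indep_means P mu.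
Local Notation nice := (nice mu).
Local Notation EE := (EE P mu).

Context {Y : finType}.
(** [kap i t] is the law of the observation of arm [i] when its mean is [t]. It may depend on [i]
    because masked arms show a constant. *)
Variables (kap : 'I_K -> R -> Y -> R) (est : Y -> R) (eps : R) (j : 'I_K).
Hypothesis kap_nice : forall i k y, nice (fun a => kap k (a i) y).
Hypothesis kap_ge0 : forall i t y, 0 <= t <= 1 -> 0 <= kap i t y.
Hypothesis kap_sum1 : forall i t, \sum_y kap i t y = 1.
Hypothesis est_close : forall (i : 'I_K) t, (i <= j)%N -> 0 <= t <= 1 ->
  \sum_y kap i t y * `|est y - t| <= eps.
Variable V : ('I_K -> R) -> R.
Implicit Types (a : 'I_K -> R) (q : 'I_K -> R).
Hypothesis V_nice : nice V.
Hypothesis V01 : forall a, cube a -> 0 <= V a <= 1.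
Hypothesis V_noj : forall a b : 'I_K -> R, (forall i, i != j -> a i = b i) -> V a = V b.

Definition lik (a : 'I_K -> R) (y : {ffun 'I_K -> Y}) : R := prodw (fun i => kap i (a i)) y.

Definition mean_test (alpha : {ffun 'I_K -> Y} -> R) (a : 'I_K -> R) : R :=
  \sum_y lik a y * alpha y.

Definition mix (q : 'I_K -> R) (a : 'I_K -> R) : R := \sum_(i < K | (i < j)%N) q i * a i.

(** Unnormalised posterior surplus of arm [j] over the mixture [q] after observing [y], under the
    prior tilted by [V]. *)
Definition gain (q : 'I_K -> R) (y : {ffun 'I_K -> Y}) : R :=
  EE (fun a => (a j - mix q a) * V a * lik a y).

Definition bayes_test (q : 'I_K -> R) (y : {ffun 'I_K -> Y}) : R := (0 < gain q y)%R%:R.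

Lemma lik_nice y : nice (fun a => lik a y).
Proof. by apply: nice_prod => i; exact: kap_nice. Qed.

Lemma lik_ge0 a y : cube a -> 0 <= lik a y.
Proof. by move=> ca; apply: prodr_ge0 => i _; exact: kap_ge0. Qed.

Lemma lik_sum1 a : \sum_y lik a y = 1.
Proof. by apply: prodw_sum1 => i; exact: kap_sum1. Qed.

Lemma mix_nice q : nice (mix q).
Proof. by apply: nice_sum => i; apply: niceZ; exact: nice_coord. Qed.

Lemma mean_test_nice alpha : nice (mean_test alpha).
Proof. by apply: nice_sum => y; apply: niceM; [exact: lik_nice | exact: nice_cst]. Qed.

Lemma mean_test01 alpha a : (forall y, 0 <= alpha y <= 1) -> cube a ->
  0 <= mean_test alpha a <= 1.
Proof.
move=> alpha01 ca; rewrite /mean_test; apply/andP; split.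
  by apply: sumr_ge0 => y _; rewrite mulr_ge0 ?lik_ge0 //; case/andP: (alpha01 y).
rewrite -(lik_sum1 a); apply: ler_sum => y _.
by rewrite ler_piMr ?lik_ge0 //; case/andP: (alpha01 y).
Qed.

Lemma EE_mean_test W alpha : nice W ->
  EE (fun a => W a * mean_test alpha a) = \sum_y EE (fun a => W a * lik a y) * alpha y.
Proof.
move=> nW; have nWl y : nice (fun a => W a * lik a y) by apply: niceM => //; exact: lik_nice.
transitivity (EE (fun a => \sum_y alpha y * (W a * lik a y))).
  by congr EE; apply/funext => a; rewrite /mean_test mulr_sumr; apply: eq_bigr => y _; ring.
rewrite EE_sum // => [|y]; last exact: niceZ.
by apply: eq_bigr => y _; rewrite EEZ // mulrC.
Qed.

(** Acting on the sign of an estimate [x] of [z] loses at most [|x - z|] against the positive part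
    of [z]. The mean error is at most [eps] for arm [j] plus [eps] for the mixture. *)
Lemma empirical_test_gain q a : cube a -> (forall i, 0 <= q i) ->
  \sum_(i < K | (i < j)%N) q i = 1 ->
  Num.max (a j - mix q a) 0 - 2 * eps <=
  (a j - mix q a) * mean_test (fun y =>
    (0 < est (y j) - \sum_(i < K | (i < j)%N) q i * est (y i))%R%:R) a.
Proof.
move=> ca q0 q1; set D := a j - mix q a.
set Dhat := fun y : {ffun 'I_K -> Y} => est (y j) - \sum_(i < K | (i < j)%N) q i * est (y i).
have err y : `|Dhat y - D| <=
    `|est (y j) - a j| + \sum_(i < K | (i < j)%N) q i * `|est (y i) - a i|.
  rewrite /Dhat /D /mix (_ : _ - _ =
    (est (y j) - a j) - \sum_(i < K | (i < j)%N) q i * (est (y i) - a i)); last first.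
    under [in RHS]eq_bigr do rewrite mulrBr; rewrite sumrB; ring.
  apply: le_trans (ler_normB _ _) _; rewrite lerD2l; apply: le_trans (ler_norm_sum _ _ _) _.
  by apply: ler_sum => i _; rewrite normrM (ger0_norm (q0 i)).
have marg (i : 'I_K) : (i <= j)%N -> \sum_y lik a y * `|est (y i) - a i| <= eps.
  move=> ij; rewrite /lik (@prodw_marginal _ _ _ _ i (fun b => `|est b - a i|)) => [|k].
    by apply: est_close => //; exact: ca.
  exact: kap_sum1.
have total : \sum_y lik a y * `|Dhat y - D| <= 2 * eps.
  apply: le_trans (_ : \sum_y lik a y * (`|est (y j) - a j| +
      \sum_(i < K | (i < j)%N) q i * `|est (y i) - a i|) <= _).
    by apply: ler_sum => y _; apply: ler_wpM2l; [exact: lik_ge0 | exact: err].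
  under eq_bigr do rewrite mulrDr; rewrite big_split /= mulr_natl mulr2n.
  apply: lerD; first exact: marg.
  under eq_bigr do rewrite mulr_sumr; rewrite exchange_big /=.
  rewrite -[leRHS]mul1r -q1 mulr_suml; apply: ler_sum => i ij.
  under eq_bigr do rewrite mulrCA; rewrite -mulr_sumr.
  by apply: ler_wpM2l => //; apply: marg; exact: ltnW.
apply: le_trans (lerB (lexx _) total) _; rewrite /mean_test.
rewrite -[X in X - _]mul1r -{1}(lik_sum1 a) mulr_suml -sumrB mulr_sumr.
apply: ler_sum => y _; rewrite -mulrBr mulrCA; apply: ler_wpM2l; first exact: lik_ge0.
rewrite -/(Dhat y); move: (Dhat y) => x; clearbody D; clear err total Dhat; move: D => z.
have := ler_norm (x - z); have := ler_norm (z - x); rewrite distrC.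
by case: (ltP 0 x) => ?; case: (leP z 0) => ?; rewrite ?mulr1 ?mulr0; lra.
Qed.

(** The Bayes test is optimal separately for each observation [y], so it does at least as well as
    the empirical test, whose gain is computable. *)
Lemma bayes_test_gain q (g : R) : (forall i, 0 <= q i) ->
  \sum_(i < K | (i < j)%N) q i = 1 ->
  g <= EE (fun a => Num.max (a j - mix q a) 0 * V a) ->
  g - 2 * eps * EE V <= EE (fun a => (a j - mix q a) * V a * mean_test (bayes_test q) a).
Proof.
move=> q0 q1 gG.
have nD : nice (fun a => a j - mix q a).
  by apply: niceB; [exact: nice_coord | exact: mix_nice].
have nDV := niceM nD V_nice.
have nmV : nice (fun a => Num.max (a j - mix q a) 0 * V a) by apply: niceM => //; exact: nice_max0.
pose emp (y : {ffun 'I_K -> Y}) : R :=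
  (0 < est (y j) - \sum_(i < K | (i < j)%N) q i * est (y i))%R%:R.
apply: le_trans (_ : EE (fun a => (a j - mix q a) * V a * mean_test emp a) <= _).
  apply: le_trans (lerB gG (lexx _)) _; rewrite -EEZ // -EEB //; last exact: niceZ.
  apply: EE_le => //; first by apply: niceB => //; exact: niceZ.
    by apply: niceM => //; exact: mean_test_nice.
  move=> a ca; have /andP[V0 _] := V01 ca; have := empirical_test_gain ca q0 q1.
  rewrite -/emp; move=> /(ler_wpM2r V0); rewrite mulrBl => h.
  by apply: le_trans h _; rewrite mulrAC.
rewrite !EE_mean_test //; apply: ler_sum => y _; rewrite -/(gain q y) /bayes_test /emp.
by case: (ltP 0 (gain q y)) => g0; case: (ltP 0 _) => e0; rewrite ?mulr1 ?mulr0 // ltW.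
Qed.

(** Fix the observations of the other arms. By independence the gain as a function of the
    observation [b] of arm [j] is [M b * A1 - L b * B1], so the Bayes test accepts when the
    posterior mean [M b / L b] of arm [j] is large. Such a selection can only raise the mean of that
    arm. *)
Lemma bayes_test_mean q :
  0 <= EE (fun a => (a j - EE (fun b => b j)) * V a * mean_test (bayes_test q) a).
Proof.
set m := EE (fun b => b j).
have nj := nice_coord mu_meas j.
have nD : nice (fun a => a j - m) by apply: niceB => //; exact: nice_cst.
rewrite EE_mean_test; last exact: niceM.
apply: (@sum_ge0_coord _ _ _ j) => c.
pose M b := EE (fun a => a j * kap j (a j) b).
pose L b := EE (fun a => kap j (a j) b).
pose W a := \prod_(i < K | i != j) kap i (a i) (c i).
have nW : nice W by apply: nice_prod => i; exact: kap_nice.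
have W_noj a (b : 'I_K -> R) : (forall i, i != j -> a i = b i) -> W a = W b.
  by move=> ab; apply: eq_bigr => i ij; rewrite ab.
have mix_noj a (b : 'I_K -> R) : (forall i, i != j -> a i = b i) -> mix q a = mix q b.
  move=> ab; apply: eq_bigr => i ij; rewrite ab //.
  by apply: contraTneq ij => ->; rewrite ltnn.
have likE a b : lik a (upd c j b) = kap j (a j) b * W a.
  rewrite /lik /prodw (bigD1 j) //= upd_same; congr (_ * _).
  by apply: eq_bigr => i ij; rewrite upd_other.
pose A1 := EE (fun a => V a * W a); pose B1 := EE (fun a => mix q a * V a * W a).
have nM b : nice (fun a => a j * kap j (a j) b) by apply: niceM.
have nA : nice (fun a => V a * W a) by apply: niceM.
have nB : nice (fun a => mix q a * V a * W a) by do !apply: niceM => //; exact: mix_nice.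
have A0 : 0 <= A1.
  apply: EE_ge0 => // a ca; apply: mulr_ge0; first by case/andP: (V01 ca).
  by apply: prodr_ge0 => i _; exact: kap_ge0.
have EM b : EE (fun a => a j * V a * lik a (upd c j b)) = M b * A1.
  rewrite /M /A1 -(EE_factor mu_meas mu01 mu_indep (k := j)) //.
  - by congr EE; apply/funext => a; rewrite likE; ring.
  - by move=> a a' _ _ ->.
  - by move=> a a' _ _ aa; rewrite (V_noj aa) (W_noj _ _ aa).
have EL b : EE (fun a => V a * lik a (upd c j b)) = L b * A1.
  rewrite /L /A1 -(EE_factor mu_meas mu01 mu_indep (k := j)) //.
  - by congr EE; apply/funext => a; rewrite likE; ring.
  - by move=> a a' _ _ ->.
  - by move=> a a' _ _ aa; rewrite (V_noj aa) (W_noj _ _ aa).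
have EB b : EE (fun a => mix q a * V a * lik a (upd c j b)) = L b * B1.
  rewrite /L /B1 -(EE_factor mu_meas mu01 mu_indep (k := j)) //.
  - by congr EE; apply/funext => a; rewrite likE; ring.
  - by move=> a a' _ _ ->.
  - by move=> a a' _ _ aa; rewrite (mix_noj _ _ aa) (V_noj aa) (W_noj _ _ aa).
have nl y := lik_nice y.
have gainE b : gain q (upd c j b) = M b * A1 - L b * B1.
  rewrite -EM -EB -EEB //.
  - by congr EE; apply/funext => a; ring.
  - by do !apply: niceM.
  - by do !apply: niceM => //; exact: mix_nice.
have termE b : EE (fun a => (a j - m) * V a * lik a (upd c j b)) = (M b - m * L b) * A1.
  rewrite mulrBl -mulrA -EM -EL -EEZ //; last exact: niceM.
  rewrite -EEB //.
  - by congr EE; apply/funext => a; ring.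
  - by do !apply: niceM.
  - by apply: niceZ; exact: niceM.
under eq_bigr do rewrite termE /bayes_test gainE.
apply: threshold_sum_ge0 => //.
- by move=> b; apply: EE_ge0 => // a ca; exact: kap_ge0.
- rewrite -EE_sum //; congr EE; apply/funext => a.
  by rewrite -mulr_sumr kap_sum1 mulr1.
- rewrite -EE_sum // -[RHS](EE_cst P mu); congr EE; apply/funext => a; exact: kap_sum1.
Qed.

(** The response to a direction [q] is [bayes_test q], with payoff vector [v q]. The average of the
    responses produced by approachability is again a test, and both conclusions survive averaging
    because they are linear in the test. *)
Lemma padded_test (g delta : R) : (0 < j)%N -> 0 < delta ->
  `|g - 2 * eps * EE V| <= 1 ->
  (forall q, (forall i, 0 <= q i) -> \sum_(i < K | (i < j)%N) q i = 1 ->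
    g <= EE (fun a => Num.max (a j - mix q a) 0 * V a)) ->
  exists alpha : {ffun 'I_K -> Y} -> R, [/\ forall y, 0 <= alpha y <= 1,
    forall i : 'I_K, (i < j)%N ->
      g - 2 * eps * EE V - delta <= EE (fun a => (a j - a i) * V a * mean_test alpha a) &
    0 <= EE (fun a => (a j - EE (fun b => b j)) * V a * mean_test alpha a)].
Proof.
move=> j0 delta0 g1 gG.
have nD i : nice (fun a => (a j - a i) * V a).
  by apply: niceM => //; apply: niceB; exact: nice_coord.
have bt01 q y : 0 <= bayes_test q y <= 1 by rewrite /bayes_test; case: ltP; rewrite ?lexx ?ler01.
pose v q i := EE (fun a => (a j - a i) * V a * mean_test (bayes_test q) a).
have v1 q i : `|v q i| <= 1.
  have nv : nice (fun a => (a j - a i) * V a * mean_test (bayes_test q) a).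
    by apply: niceM => //; exact: mean_test_nice.
  have pt a : cube a -> `|(a j - a i) * V a * mean_test (bayes_test q) a| <= 1.
    move=> ca; rewrite !normrM.
    have /andP[t0 t1] := mean_test01 (bt01 q) ca; have /andP[V0 V1] := V01 ca.
    rewrite (ger0_norm t0) (ger0_norm V0).
    apply: mulr_ile1 => //; [exact: mulr_ge0 | apply: mulr_ile1 => //].
    have := ca i; have := ca j; rewrite ler_norml; lra.
  rewrite ler_norml; apply/andP; split.
    rewrite -(EE_cst P mu (-1)); apply: EE_le => // [|a /pt]; first exact: nice_cst.
    by rewrite ler_norml => /andP[].
  rewrite -(EE_cst P mu 1); apply: EE_le => // [|a /pt]; first exact: nice_cst.
  by rewrite ler_norml => /andP[].
have [|l [l0 Hl]] := @approachability _ _ _ (fun i : 'I_K => (i < j)%N) v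
    (g - 2 * eps * EE V) (Ordinal (ltn_trans j0 (ltn_ord j))) delta j0 g1 v1 _ delta0.
- move=> q q0 q_off q1; have q1' : \sum_(i < K | (i < j)%N) q i = 1.
    rewrite -q1 [RHS](bigID (fun i : 'I_K => (i < j)%N)) /= [X in _ = _ + X]big1 ?addr0 //.
  exists q; apply: le_trans (bayes_test_gain q0 q1' (gG q q0 q1')) _.
  rewrite le_eqVlt; apply/orP; left; apply/eqP.
  rewrite [RHS](eq_bigr (fun i =>
      EE (fun a => q i * ((a j - a i) * V a * mean_test (bayes_test q) a)))); last first.
    by move=> i _; rewrite EEZ //; apply: niceM => //; exact: mean_test_nice.
  rewrite -EE_sum // => [|i]; last by apply: niceZ; apply: niceM => //; exact: mean_test_nice.
  congr EE; apply/funext => a; under [RHS]eq_bigr do rewrite !mulrA.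
  rewrite -!mulr_suml; congr (_ * _ * _); under eq_bigr do rewrite mulrBr.
  rewrite sumrB -mulr_suml q1 mul1r; congr (_ - _).
  rewrite [RHS](bigID (fun i : 'I_K => (i < j)%N)) /= [X in _ = _ + X]big1 ?addr0 //.
  by move=> i ij; rewrite q_off // mul0r.
have sz0 : 0 < (size l)%:R :> R by rewrite ltr0n.
exists (fun y => (\sum_(q <- l) bayes_test q y) / (size l)%:R).
have meanE a : mean_test (fun y => (\sum_(q <- l) bayes_test q y) / (size l)%:R) a =
    (size l)%:R^-1 * \sum_(q <- l) mean_test (bayes_test q) a.
  rewrite /mean_test exchange_big /= mulr_sumr; apply: eq_bigr => y _.
  by rewrite -mulr_sumr; ring.
have EEl W : nice W -> EE (fun a => W a * mean_test (fun y =>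
    (\sum_(q <- l) bayes_test q y) / (size l)%:R) a) =
    (size l)%:R^-1 * \sum_(q <- l) EE (fun a => W a * mean_test (bayes_test q) a).
  move=> nW; have nq q : nice (fun a => W a * mean_test (bayes_test q) a).
    by apply: niceM => //; exact: mean_test_nice.
  rewrite -EE_sum // -EEZ //; last exact: nice_sum.
  by congr EE; apply/funext => a; rewrite meanE -mulr_sumr mulrCA.
split.
- move=> y; apply/andP; split.
    by rewrite divr_ge0 // sumr_ge0 // => q _; case/andP: (bt01 q y).
  rewrite ler_pdivrMr // mul1r -sum1_size natr_sum; apply: ler_sum => q _.
  by case/andP: (bt01 q y).
- by move=> i ij; rewrite EEl // [leRHS]mulrC ler_pdivlMr //; exact: Hl.
- rewrite EEl; last first.
    by apply: niceM => //; apply: niceB; [exact: nice_coord | exact: nice_cst].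
  by rewrite mulr_ge0 // ?invr_ge0 // sumr_ge0 // => q _; exact: bayes_test_mean.
Qed.

End Padding.

(** * Bernoulli samples *)

Section Bernoulli.
Context {R : realType}.
Implicit Types (t : R) (s : seq bool).

Lemma sum_tuple0 {V : nmodType} (T : finType) (F : seq T -> V) :
  \sum_(u : 0.-tuple T) F u = F [::].
Proof. by rewrite (big_pred1 [tuple]) // => u; apply/esym/eqP; exact: tuple0. Qed.

Lemma sum_tuple_cons {V : nmodType} (T : finType) n (F : seq T -> V) :
  \sum_(u : n.+1.-tuple T) F u = \sum_(b : T) \sum_(u : n.-tuple T) F (b :: u).
Proof.
rewrite pair_bigA /= (reindex (fun p : T * n.-tuple T => [tuple of p.1 :: p.2])) //=.
exists (fun u : n.+1.-tuple T => (thead u, [tuple of behead u])) => [[b u] _|u _] /=.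
  by rewrite theadE; congr pair; apply: val_inj.
by rewrite -tuple_eta.
Qed.

Lemma sum_tuple_cat {V : nmodType} (T : finType) m n (F : seq T -> V) :
  \sum_(u : (m + n).-tuple T) F u =
  \sum_(u1 : m.-tuple T) \sum_(u2 : n.-tuple T) F (u1 ++ u2).
Proof.
elim: m F => [|m IH] F.
  by rewrite (sum_tuple0 (fun v : seq T => \sum_(u2 : n.-tuple T) F (v ++ u2))).
rewrite (@sum_tuple_cons _ _ (m + n)).
rewrite (@sum_tuple_cons _ _ m (fun v : seq T => \sum_(u2 : n.-tuple T) F (v ++ u2))).
by apply: eq_bigr => b _; rewrite (IH (fun u => F (b :: u))).
Qed.

Definition bern t (b : bool) : R := if b then t else 1 - t.

Definition bern_seq t s : R := \prod_(b <- s) bern t b.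

Lemma bern_seq_cons t b s : bern_seq t (b :: s) = bern t b * bern_seq t s.
Proof. exact: big_cons. Qed.

Lemma bern_seq_cat t s1 s2 : bern_seq t (s1 ++ s2) = bern_seq t s1 * bern_seq t s2.
Proof. exact: big_cat. Qed.

Lemma bern_seq_ge0 t s : 0 <= t <= 1 -> 0 <= bern_seq t s.
Proof. by move=> /andP[t0 t1]; apply: prodr_ge0 => -[] _; rewrite /bern ?subr_ge0. Qed.

Lemma sum_bern t (F : bool -> R) : \sum_b bern t b * F b = t * F true + (1 - t) * F false.
Proof. by rewrite big_bool. Qed.

Lemma sum_bern_seq_cons t n (F : seq bool -> R) :
  \sum_(u : n.+1.-tuple bool) bern_seq t u * F u =
  \sum_b bern t b * \sum_(u : n.-tuple bool) bern_seq t u * F (b :: u).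
Proof.
rewrite (@sum_tuple_cons _ _ n (fun s => bern_seq t s * F s)).
apply: eq_bigr => b _; rewrite mulr_sumr; apply: eq_bigr => u _.
by rewrite bern_seq_cons mulrA.
Qed.

Lemma sum_bern_seq_cat t m n (F : seq bool -> R) :
  \sum_(u : (m + n).-tuple bool) bern_seq t u * F u =
  \sum_(u1 : m.-tuple bool) bern_seq t u1 *
    \sum_(u2 : n.-tuple bool) bern_seq t u2 * F (u1 ++ u2).
Proof.
rewrite (@sum_tuple_cat _ _ m n (fun s => bern_seq t s * F s)).
apply: eq_bigr => u1 _; rewrite mulr_sumr; apply: eq_bigr => u2 _.
by rewrite bern_seq_cat mulrA.
Qed.

Lemma sum_bern_seq1 t n : \sum_(u : n.-tuple bool) bern_seq t u = 1.
Proof.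
elim: n => [|n IH].
  by rewrite (sum_tuple0 (bern_seq t)) /bern_seq big_nil.
under eq_bigr do rewrite -[bern_seq _ _]mulr1.
rewrite (@sum_bern_seq_cons t n (fun _ => 1)).
under eq_bigr do under eq_bigr do rewrite mulr1.
rewrite sum_bern IH; ring.
Qed.

Lemma sum_bern_zeros t n : \sum_(u : n.-tuple bool) bern_seq t u * (all negb u)%:R = (1 - t) ^+ n.
Proof.
elim: n => [|n IH].
  by rewrite (sum_tuple0 (fun s => bern_seq t s * (all negb s)%:R)) /bern_seq big_nil mulr1.
rewrite (@sum_bern_seq_cons t n (fun s => (all negb s)%:R)) sum_bern /= IH exprS.
by rewrite big1 ?mulr0 ?add0r // => u _; rewrite mulr0.
Qed.

Definition centered t s : R := \sum_(b <- s) (b%:R - t).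

Lemma sum_bern_centered t n : \sum_(u : n.-tuple bool) bern_seq t u * centered t u = 0.
Proof.
elim: n => [|n IH].
  by rewrite (sum_tuple0 (fun s => bern_seq t s * centered t s)) /centered big_nil mulr0.
rewrite (@sum_bern_seq_cons t n (centered t)) sum_bern.
have E b : \sum_(u : n.-tuple bool) bern_seq t u * centered t (b :: u) = b%:R - t.
  under eq_bigr do rewrite /centered big_cons mulrDr -/(centered t _).
  by rewrite big_split /= IH -mulr_suml sum_bern_seq1 mul1r addr0.
by rewrite !E /=; ring.
Qed.

Lemma sum_bern_centered2 t n :
  \sum_(u : n.-tuple bool) bern_seq t u * centered t u ^+ 2 = n%:R * (t * (1 - t)).
Proof.
elim: n => [|n IH].
  rewrite (sum_tuple0 (fun s => bern_seq t s * centered t s ^+ 2)).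
  by rewrite /centered big_nil expr0n mulr0 mul0r.
rewrite (@sum_bern_seq_cons t n (fun s => centered t s ^+ 2)) sum_bern.
have E b : \sum_(u : n.-tuple bool) bern_seq t u * centered t (b :: u) ^+ 2 =
    (b%:R - t) ^+ 2 + n%:R * (t * (1 - t)).
  transitivity (\sum_(u : n.-tuple bool) (bern_seq t u * (b%:R - t) ^+ 2 +
      2 * (b%:R - t) * (bern_seq t u * centered t u) + bern_seq t u * centered t u ^+ 2)).
    apply: eq_bigr => u _; rewrite {1}/centered big_cons -/(centered t _); ring.
  rewrite !big_split /= IH -mulr_suml sum_bern_seq1 mul1r -mulr_sumr.
  by rewrite sum_bern_centered mulr0 addr0.
by rewrite !E /= -natr1; ring.
Qed.

Definition sample_mean n (u : n.-tuple bool) : R := (\sum_(b <- u) b%:R) / n%:R.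

(** The variance of the sample mean is at most [1 / (4 * n)]. The free parameter [s] takes the place
    of the square root in Cauchy-Schwarz. *)
Lemma sample_mean_close t n (s : R) : (0 < n)%N -> 0 < s -> 0 <= t <= 1 ->
  \sum_(u : n.-tuple bool) bern_seq t u * `|sample_mean u - t| <= ((4 * n%:R * s)^-1 + s) / 2.
Proof.
move=> n0 s0 t01; have n0' : 0 < n%:R :> R by rewrite ltr0n.
have E (u : n.-tuple bool) : sample_mean u - t = centered t u / n%:R.
  rewrite /sample_mean /centered sumrB big_const_seq count_predT size_tuple iter_addr_0.
  by rewrite mulrBl -[t *+ n]mulr_natr mulfK // gt_eqF.
(* AM-GM: |z| <= (z^2 / s + s) / 2 *)
have amgm (z : R) : `|z| <= (z ^+ 2 / s + s) / 2.
  rewrite -subr_ge0 (_ : _ - _ = (`|z| - s) ^+ 2 / (2 * s)); last first.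
    by rewrite -(real_normK (num_real z)); field; rewrite gt_eqF.
  by rewrite divr_ge0 ?sqr_ge0 // mulr_ge0 // ltW.
apply: le_trans (_ : \sum_(u : n.-tuple bool) bern_seq t u *
    ((centered t u ^+ 2 / (n%:R ^+ 2 * s) + s) / 2) <= _).
  apply: ler_sum => u _; apply: ler_wpM2l; first exact: bern_seq_ge0.
  by apply: le_trans (amgm _) _; rewrite E expr_div_n -mulrA -invfM.
rewrite (_ : \sum_u _ = \sum_(u : n.-tuple bool) (bern_seq t u * centered t u ^+ 2 *
    (2 * n%:R ^+ 2 * s)^-1 + bern_seq t u * (s / 2))); last first.
  by apply: eq_bigr => u _; field; rewrite !gt_eqF.
rewrite big_split /= -!mulr_suml sum_bern_centered2 sum_bern_seq1 mul1r.
rewrite [leRHS]mulrDl lerD2r.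
rewrite (_ : n%:R * (t * (1 - t)) / (2 * n%:R ^+ 2 * s) = (t * (1 - t)) / (2 * n%:R * s)); last first.
  by field; rewrite !gt_eqF.
rewrite (_ : (4 * n%:R * s)^-1 / 2 = 4^-1 / (2 * n%:R * s)); last first.
  by field; rewrite !gt_eqF.
apply: ler_wpM2r; first by rewrite invr_ge0 !mulr_ge0 // ltW.
have := sqr_ge0 (t - 2^-1); rewrite expr2; lra.
Qed.

End Bernoulli.

(** * Zeros and test batches given the means *)

Section Tables.
Context {R : realType} {K : nat}.
Implicit Types (a : 'I_K -> R) (X : 'I_K -> nat -> bool).

Definition view M (x : table K M) : 'I_K -> nat -> bool := fun i n => nth false (x i) n.

(** Version of [zeros] on unbounded sample arrays, so that it can be read both from a table and from
    a history. *)
Definition zeros_seen (j Nb : nat) X : bool :=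
  [forall i : 'I_K, (i < j)%N ==> [forall k : 'I_Nb, ~~ X i k]].

Definition second_batch N (X : nat -> bool) : N.-tuple bool := [tuple X (N + k)%N | k < N].

(* The arms above [j] need not have been played yet, hence are masked. *)
Definition batch_seen N (j : 'I_K) X : {ffun 'I_K -> N.-tuple bool} :=
  [ffun i : 'I_K => if (i <= j)%N then second_batch N (X i) else [tuple false | _ < N]].

Definition batch_kernel N (j i : 'I_K) (t : R) (y : N.-tuple bool) : R :=
  if (i <= j)%N then bern_seq t y else (y == [tuple false | _ < N])%:R.

Definition zeros_prob (j Nb : nat) a : R := \prod_(i < K | (i < j)%N) (1 - a i) ^+ Nb.

Definition bern_table M a (x : table K M) : R := \prod_i bern_seq (a i) (x i).

Lemma table_likE d (Omega : measurableType d) (mu : 'I_K -> Omega -> R) M w (x : table K M) :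
  table_lik mu w x = bern_table (mu ^~ w) x.
Proof. by apply: eq_bigr => i _; rewrite /bern_seq big_tuple. Qed.

Lemma bern_table_sum1 M a : \sum_(x : table K M) bern_table a x = 1.
Proof.
by rewrite -(bigA_distr_bigA (fun i (u : M.-tuple bool) => bern_seq (a i) u)) big1 // => i _;
  rewrite sum_bern_seq1.
Qed.

Lemma batch_kernel_sum1 N j i (t : R) : \sum_y @batch_kernel N j i t y = 1.
Proof.
rewrite /batch_kernel; case: (i <= j)%N; first exact: sum_bern_seq1.
by rewrite (bigD1 [tuple false | _ < N]) //= eqxx big1 ?addr0 // => y /negPf ->.
Qed.

Lemma sum_bern_prefix (t : R) m n (F : seq bool -> R) :
  \sum_(u : (m + n).-tuple bool) bern_seq t u * F (take m u) =
  \sum_(u : m.-tuple bool) bern_seq t u * F u.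
Proof.
rewrite (@sum_bern_seq_cat R t m n (fun s => F (take m s))).
apply: eq_bigr => u _; under eq_bigr do rewrite take_size_cat ?size_tuple //.
by rewrite -mulr_suml sum_bern_seq1 mul1r.
Qed.

Lemma sum_bern_batches (t : R) N r (F G : seq bool -> R) :
  \sum_(u : (N + (N + r)).-tuple bool) bern_seq t u * (F (take N u) * G (take N (drop N u))) =
  (\sum_(u : N.-tuple bool) bern_seq t u * F u) * (\sum_(u : N.-tuple bool) bern_seq t u * G u).
Proof.
rewrite (@sum_bern_seq_cat R t N (N + r) (fun s => F (take N s) * G (take N (drop N s)))).
rewrite mulr_suml; apply: eq_bigr => u _.
under eq_bigr do rewrite take_size_cat ?size_tuple // drop_size_cat ?size_tuple // mulrCA.
by rewrite -mulr_sumr (@sum_bern_prefix t N r G) mulrA.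
Qed.

(** Contribution of one arm to [table_batches]: [b] tells whether its zeros are required, [c]
    whether its second batch is unmasked. *)
Lemma arm_batches (t : R) N r Nb (b c : bool) (y : N.-tuple bool) : (Nb <= N)%N ->
  \sum_(u : (N + (N + r)).-tuple bool) bern_seq t u *
    ((b ==> [forall k : 'I_Nb, ~~ nth false u k])%:R *
     (y == if c then second_batch N (nth false u) else [tuple false | _ < N])%:R) =
  (if b then (1 - t) ^+ Nb else 1) *
  (if c then bern_seq t y else (y == [tuple false | _ < N])%:R).
Proof.
move=> NbN.
pose F (s : seq bool) : R := (b ==> all negb (take Nb s))%:R.
pose G (s : seq bool) : R := (if c then tval y == s else y == [tuple false | _ < N])%:R.
transitivity (\sum_(u : (N + (N + r)).-tuple bool)
    bern_seq t u * (F (take N u) * G (take N (drop N u)))).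
  apply: eq_bigr => u _; rewrite /F /G; congr (_ * (_%:R * _%:R)).
    rewrite take_takel //; congr (b ==> _).
    have sz : size (take Nb u) = Nb.
      by rewrite size_takel // size_tuple (leq_trans NbN) // leq_addr.
    apply/forallP/(all_nthP false) => [h i|h k].
      rewrite sz => iNb; rewrite nth_take //; exact: (h (Ordinal iNb)).
    by have := h k; rewrite sz nth_take //; apply.
  case: (c) => //; rewrite -val_eqE /=; congr (_ == _).
  have sz : size (take N (drop N u)) = N.
    by rewrite size_takel // size_drop size_tuple addnC addnK leq_addr.
  apply: (@eq_from_nth _ false); first by rewrite sz size_map size_enum_ord.
  move=> i; rewrite size_map size_enum_ord => iN.
  rewrite (nth_map (Ordinal iN)) ?size_enum_ord // nth_take // nth_drop.
  by rewrite (nth_enum_ord (Ordinal iN)).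
rewrite sum_bern_batches; congr (_ * _).
  rewrite /F; case: (b) => /=; last by under eq_bigr do rewrite mulr1; rewrite sum_bern_seq1.
  rewrite -(subnKC NbN) (@sum_bern_prefix t Nb (N - Nb) (fun s => (all negb s)%:R)).
  exact: sum_bern_zeros.
rewrite /G; case: (c).
  rewrite (bigD1 y) //= eqxx mulr1 big1 ?addr0 // => u; rewrite -val_eqE /= eq_sym => /negPf ->.
  by rewrite mulr0.
by rewrite -mulr_suml sum_bern_seq1 mul1r.
Qed.

(** The zeros use samples below [Nb <= N] and [phi] uses samples from [N] on, so they are
    independent given the means. Keeping [j'] apart from [j] allows [j' = 0], where the zeros impose
    nothing. *)
Lemma table_batches N r j' Nb (j : 'I_K) a (phi : {ffun 'I_K -> N.-tuple bool} -> R) :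
  (Nb <= N)%N ->
  \sum_(x : table K (N + (N + r))) bern_table a x *
    ((zeros_seen j' Nb (view x))%:R * phi (batch_seen N j (view x))) =
  zeros_prob j' Nb a * mean_test (@batch_kernel N j) phi a.
Proof.
move=> NbN; rewrite /mean_test mulr_sumr.
pose T := (N + (N + r))%N.
pose z i (u : T.-tuple bool) : R := ((i < j')%N ==> [forall k : 'I_Nb, ~~ nth false u k])%:R.
pose o (i : 'I_K) (u : T.-tuple bool) :=
  if (i <= j)%N then second_batch N (nth false u) else [tuple false | _ < N].
have zE (x : table K T) : (zeros_seen j' Nb (view x))%:R = \prod_(i < K) z i (x i).
  rewrite /zeros_seen /z; case: forallP => [h|/forallP].
    by rewrite big1 // => i _; rewrite h.
  rewrite negb_forall => /existsP[i /negPf hi].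
  by rewrite (bigD1 i) //= /view in hi *; rewrite hi mul0r.
have oE (x : table K T) (y : {ffun 'I_K -> N.-tuple bool}) :
      (y == batch_seen N j (view x))%:R = \prod_(i < K) (y i == o i (x i))%:R :> R.
  case: eqP => [->|ne]; first by rewrite big1 // => i _; rewrite ffunE eqxx.
  have [i hi] : exists i, y i != o i (x i).
    apply/existsP; rewrite -negb_forall; apply/negP => /forallP h; apply: ne.
    by apply/ffunP => i; rewrite ffunE; exact/eqP/h.
  by rewrite (bigD1 i) //= (negPf hi) mul0r.
(* Splitting [phi] over the values [y] of the batch leaves indicators that are products over the
   arms. *)
transitivity (\sum_(x : table K T) \sum_(y : {ffun 'I_K -> N.-tuple bool}) (\prod_i (bern_seq (a i) (x i) *
    (z i (x i) * (y i == o i (x i))%:R))) * phi y).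
  apply: eq_bigr => x _.
  rewrite [RHS](eq_bigr (fun y => bern_table a x * ((zeros_seen j' Nb (view x))%:R *
      (y == batch_seen N j (view x))%:R) * phi y)); last first.
    by move=> y _; rewrite big_split big_split /= -zE -oE.
  rewrite (bigD1 (batch_seen N j (view x))) //= eqxx big1 ?addr0; first by rewrite mulr1 -mulrA.
  by move=> y /negPf ->; rewrite !mulr0 mul0r.
rewrite exchange_big /=; apply: eq_bigr => y _; rewrite -mulr_suml mulrA; congr (_ * _).
rewrite -(bigA_distr_bigA (fun i (u : T.-tuple bool) => bern_seq (a i) u * (z i u * (y i == o i u)%:R))).
rewrite /zeros_prob /lik /prodw [X in _ = X * _]big_mkcond -big_split /=; apply: eq_bigr => i _.
by rewrite /z /o arm_batches.
Qed.

Lemma table_zeros M j0 a :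
  \sum_(x : table K M) bern_table a x * (zeros j0 x)%:R = zeros_prob j0 M a.
Proof.
pose z i (u : M.-tuple bool) : R := ((i < j0)%N ==> all negb u)%:R.
have zE (x : table K M) : (zeros j0 x)%:R = \prod_(i < K) z i (x i).
  rewrite /zeros /z; case: forallP => [h|/forallP].
    by rewrite big1 // => i _; rewrite h.
  rewrite negb_forall => /existsP[i /negPf hi].
  by rewrite (bigD1 i) //= hi mul0r.
under eq_bigr do rewrite zE /bern_table -big_split /=.
rewrite -(bigA_distr_bigA (fun i (u : M.-tuple bool) => bern_seq (a i) u * z i u)).
rewrite /zeros_prob [RHS]big_mkcond; apply: eq_bigr => i _; rewrite /z.
case: (i < j0)%N => /=; first exact: sum_bern_zeros.
by under eq_bigr do rewrite mulr1; rewrite sum_bern_seq1.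
Qed.

End Tables.

(** * Block policies *)

Section Runs.
Context {R : realType} {K T : nat}.
Variables (pi : policy (R := R) K) (x : table K T) (i0 : 'I_K).
Hypothesis pi_valid : valid_policy pi.

Lemma sum_tuple_rcons {V : nmodType} (U : finType) n (F : seq U -> V) :
  \sum_(u : n.+1.-tuple U) F u = \sum_(u : n.-tuple U) \sum_b F (rcons u b).
Proof.
elim: n F => [|n IH] F.
  rewrite sum_tuple_cons (sum_tuple0 (fun v => \sum_b F (rcons v b))).
  by apply: eq_bigr => b _; rewrite (sum_tuple0 (fun v => F (b :: v))).
rewrite sum_tuple_cons (@sum_tuple_cons _ _ n (fun v => \sum_b F (rcons v b))).
by apply: eq_bigr => b _; rewrite (IH (fun v => F (b :: v))).
Qed.

(** Expectation over the first [n] rounds, integrating the last round first, so that later rounds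
    can be discarded. *)
Fixpoint runE (n : nat) (f : seq 'I_K -> R) : R :=
  if n is n'.+1 then runE n' (fun s => \sum_a pi (hist x s) a * f (rcons s a))
  else f [::].

Lemma runE_ext n f g : (forall s, size s = n -> f s = g s) -> runE n f = runE n g.
Proof.
elim: n f g => [|n IH] f g fg /=; first exact: fg.
by apply: IH => s sn; apply: eq_bigr => a _; rewrite fg // size_rcons sn.
Qed.

Lemma sum_traj_weight (f : seq 'I_K -> R) :
  \sum_(s : T.-tuple 'I_K) traj_weight pi x s * f s = runE T f.
Proof.
pose w (s : seq 'I_K) := \prod_(0 <= k < size s) pi (hist x (take k s)) (nth i0 s k).
have w_rcons s a : w (rcons s a) = w s * pi (hist x s) a.
  rewrite /w size_rcons big_nat_recr //= nth_rcons ltnn eqxx -cats1 take_size_cat //.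
  congr (_ * _); rewrite !big_nat; apply: eq_bigr => k /= ks.
  by rewrite nth_cat ks takel_cat // ltnW.
have sum_w n g : \sum_(s : n.-tuple 'I_K) w s * g (val s) = runE n g.
  elim: n g => [|n IH] g.
    by rewrite (sum_tuple0 (fun s => w s * g s)) /w big_nil mul1r.
  rewrite /= -IH (@sum_tuple_rcons _ _ n (fun s => w s * g s)); apply: eq_bigr => s _.
  by rewrite mulr_sumr; apply: eq_bigr => a _; rewrite w_rcons mulrA.
rewrite -sum_w; apply: eq_bigr => s _; congr (_ * _).
rewrite /traj_weight /w size_tuple big_mkord.
by apply: eq_bigr => k _; rewrite (tnth_nth i0).
Qed.

Lemma runE_prefix n k f : runE (n + k) (fun s => f (take n s)) = runE n f.
Proof.
elim: k => [|k IH].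
  by rewrite addn0; apply: runE_ext => s sn; rewrite take_oversize ?sn.
rewrite addnS /= -IH; apply: runE_ext => s sn.
under eq_bigr do rewrite -cats1 takel_cat ?sn ?leq_addr //.
by rewrite -mulr_suml; have [_ ->] := pi_valid (hist x s); rewrite mul1r.
Qed.

End Runs.

(** * Reading samples off the history *)

Section HistoryView.
Context {K M : nat}.
Variable (x : table K M).

Definition history_view (h : history K) : 'I_K -> nat -> bool :=
  fun i n => nth false [seq p.2 | p <- h & p.1 == i] n.

Lemma hist_aux_view cnt s i : [seq p.2 | p <- hist_aux x cnt s & p.1 == i] =
  [seq nth false (x i) (cnt i + k)%N | k <- iota 0 (count_mem i s)].
Proof.
elim: s cnt => [//|a s IH] cnt /=; case: (eqVneq a i) => [->|ai] /=.
  rewrite addn0 IH eqxx; congr (_ :: _).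
  rewrite -[in RHS](addn0 1%N) iotaDl -map_comp; apply: eq_map => k /=.
  by rewrite addnA addn1.
by rewrite IH eq_sym (negPf ai) add0n.
Qed.

Lemma history_viewE s i n : (n < count_mem i s)%N ->
  history_view (hist x s) i n = view x i n.
Proof.
move=> ns; rewrite /history_view hist_aux_view /view.
by rewrite (nth_map 0%N) ?size_iota // nth_iota.
Qed.

Lemma map_fst_hist s : [seq p.1 | p <- hist x s] = s.
Proof.
rewrite /hist; move: (fun=> 0%N); elim: s => [//|a s IH] cnt /=.
by rewrite IH.
Qed.

End HistoryView.

(** * Policies that are constant on blocks *)

Section Blocks.
Context {R : realType} {K : nat}.
Variables (i0 : 'I_K) (L : nat).
Hypothesis L0 : (0 < L)%N.
Variable dec : seq 'I_K -> ('I_K -> nat -> bool) -> 'I_K -> R.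
Hypothesis dec_valid : forall m X, (forall i, 0 <= dec m X i) /\ \sum_i dec m X i = 1.

Definition expand (m : seq 'I_K) : seq 'I_K := flatten [seq nseq L a | a <- m].

Definition block_arms (s : seq 'I_K) : seq 'I_K :=
  [seq nth i0 s (k * L)%N | k <- iota 0 (size s %/ L)].

(* The arm drawn at the start of a block is read off the history afterwards, so
   the policy need not remember its private randomness. *)
Definition block_policy : policy (R := R) K := fun h =>
  let s := [seq p.1 | p <- h] in
  if (L %| size s)%N then dec (block_arms s) (history_view h)
  else fun a => (a == last i0 s)%:R.

Lemma block_policy_valid : valid_policy block_policy.
Proof.
move=> h; rewrite /block_policy; case: ifP => _; first exact: dec_valid.
split=> [i|]; first exact: ler0n.
by rewrite (bigD1 (last i0 [seq p.1 | p <- h])) //= eqxx big1 ?addr0 // => i /negPf ->.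
Qed.

Lemma expand_rcons m a : expand (rcons m a) = expand m ++ nseq L a.
Proof. by rewrite /expand map_rcons flatten_rcons. Qed.

Lemma size_expand m : size (expand m) = (size m * L)%N.
Proof.
elim/last_ind: m => [//|m a IH].
by rewrite expand_rcons size_cat IH size_nseq size_rcons mulSn addnC.
Qed.

Lemma nth_expand m k r : (r < L)%N -> (k < size m)%N ->
  nth i0 (expand m) (k * L + r) = nth i0 m k.
Proof.
move=> rL; elim/last_ind: m => [//|m a IH]; rewrite size_rcons ltnS => km.
rewrite expand_rcons nth_cat size_expand nth_rcons.
have [lt_km|ge_km] := ltnP k (size m).
  rewrite IH // ifT //; apply: leq_trans (_ : k.+1 * L <= _)%N.
    by rewrite mulSn addnC ltn_add2r.
  by rewrite leq_mul2r lt_km orbT.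
have -> : k = size m by apply/eqP; rewrite eqn_leq km ge_km.
by rewrite eqxx ifF ?ltnNge ?leq_addr // addKn nth_nseq rL.
Qed.

Lemma block_arms_expand m : block_arms (expand m) = m.
Proof.
apply: (@eq_from_nth _ i0); rewrite size_map size_iota size_expand mulnK //.
move=> k km; rewrite (nth_map 0%N) ?size_iota ?size_expand ?mulnK //.
by rewrite nth_iota ?size_expand ?mulnK // add0n -{1}[(k * L)%N]addn0 nth_expand.
Qed.

Lemma count_expand m i : count_mem i (expand m) = (count_mem i m * L)%N.
Proof.
elim/last_ind: m => [//|m a IH].
rewrite expand_rcons count_cat IH -cats1 count_cat /= count_nseq addn0 mulnDl.
by congr addn; case: (a == i); rewrite ?mul1n ?mul0n.
Qed.

Context {T : nat}.
Variable (x : table K T).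

Definition dec_at (m : seq 'I_K) : 'I_K -> R := dec m (history_view (hist x (expand m))).

Fixpoint blockE (b : nat) (f : seq 'I_K -> R) : R :=
  if b is b'.+1 then blockE b' (fun m => \sum_a dec_at m a * f (rcons m a))
  else f [::].

Lemma blockES b f : blockE b.+1 f = blockE b (fun m => \sum_a dec_at m a * f (rcons m a)).
Proof. by []. Qed.

(** Almost sure properties of runs are used in this form: only choices of nonzero weight have to
    preserve [Inv]. *)
Lemma blockE_inv (Inv : seq 'I_K -> Prop) B : Inv [::] ->
  (forall m a, (size m < B)%N -> Inv m -> dec_at m a != 0 -> Inv (rcons m a)) ->
  forall b f g, (b <= B)%N -> (forall m, size m = b -> Inv m -> f m = g m) ->
  blockE b f = blockE b g.
Proof.
move=> I0 IS; elim=> [|b IH] f g bB fg /=; first exact: fg.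
apply: IH => [|m mb Im]; first exact: ltnW.
apply: eq_bigr => a _; have [->|da] := eqVneq (dec_at m a) 0; first by rewrite !mul0r.
by rewrite fg // ?size_rcons ?mb //; apply: IS => //; rewrite mb.
Qed.

Lemma blockE_ext b f g : (forall m, size m = b -> f m = g m) -> blockE b f = blockE b g.
Proof. by move=> fg; apply: (@blockE_inv (fun _ => True) b) => // m mb _; exact: fg. Qed.

(** Total mass 1 at every decision. Constants are evaluated by taking [e = 0], hence the summands
    [0 * 0] in later proofs. *)
Lemma blockE_affine b c e f : blockE b (fun m => c + e * f m) = c + e * blockE b f.
Proof.
elim: b f => [//|b IH] f /=; rewrite -IH; apply: blockE_ext => m _.
under eq_bigr do rewrite mulrDr.
rewrite big_split /= -mulr_suml; have [_ ->] := dec_valid m (history_view (hist x (expand m))).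
by rewrite mul1r mulr_sumr; congr (_ + _); apply: eq_bigr => a _; rewrite mulrCA.
Qed.

Lemma block_policy_start m : block_policy (hist x (expand m)) = dec_at m.
Proof. by rewrite /block_policy map_fst_hist size_expand dvdn_mull // block_arms_expand. Qed.

Lemma block_policy_inside m r a : (0 < r < L)%N ->
  block_policy (hist x (expand m ++ nseq r a)) = fun b => (b == a)%:R.
Proof.
case: r => [//|r] rL; rewrite /block_policy map_fst_hist size_cat size_expand size_nseq.
rewrite dvdn_addr ?dvdn_mull // gtnNdvd //; apply/funext => b.
by rewrite last_cat /=; congr (_ == _)%:R; elim: r {rL}.
Qed.

(** A block involves one random choice, at its first round; the other rounds repeat it with
    probability 1. *)
Lemma runE_blocks b f : runE block_policy x (b * L) f = blockE b (f \o expand) /\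
  forall r, (0 < r <= L)%N -> runE block_policy x (b * L + r) f =
    blockE b (fun m => \sum_a dec_at m a * f (expand m ++ nseq r a)).
Proof.
have inside n : (forall g, runE block_policy x (n * L) g = blockE n (g \o expand)) ->
    forall r, (0 < r <= L)%N -> forall g, runE block_policy x (n * L + r) g =
      blockE n (fun m => \sum_a dec_at m a * g (expand m ++ nseq r a)).
  move=> start; elim=> [//|r IHr] /andP[_ rL] g; rewrite addnS /=.
  have [->|r0] := posnP r.
    rewrite addn0 start; apply: blockE_ext => m _ /=; apply: eq_bigr => a _.
    by rewrite block_policy_start cats1.
  have rL' : (0 < r <= L)%N by rewrite r0 ltnW.
  rewrite (IHr rL'); apply: blockE_ext => m _; apply: eq_bigr => a _.
  rewrite block_policy_inside ?r0 //; congr (_ * _).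
  rewrite (bigD1 a) //= eqxx mul1r big1 ?addr0; last by move=> c /negPf ->; rewrite mul0r.
  by rewrite rcons_cat (_ : rcons (nseq r a) a = nseq r.+1 a) //; elim: (r) => //= k ->.
suff start n g : runE block_policy x (n * L) g = blockE n (g \o expand).
  by split=> // r rL; apply: inside.
elim: n g => [//|n IH] g; rewrite mulSn addnC inside ?L0 ?leqnn // /=.
by apply: blockE_ext => m _; apply: eq_bigr => a _; rewrite expand_rcons.
Qed.

(** Every round of a block has the law of the block's decision, so incentives need only be checked
    once per block. *)
Lemma block_marginal b r i : (r < L)%N -> (b * L + r < T)%N ->
  runE block_policy x T (fun s => (nth i0 s (b * L + r) == i)%:R) =
  blockE b (fun m => dec_at m i).
Proof.
move=> rL bT; pose f (s : seq 'I_K) : R := (nth i0 s (b * L + r) == i)%:R.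
transitivity (runE block_policy x (b * L + r.+1 + (T - (b * L + r.+1))) (fun s => f (take (b * L + r.+1) s))).
  rewrite subnKC ?addnS //; apply: runE_ext => s _.
  by rewrite /f nth_take // addnS.
rewrite (runE_prefix _ block_policy_valid).
rewrite (runE_blocks _ _).2 //; apply: blockE_ext => m mb.
rewrite (eq_bigr (fun a => dec_at m a * (a == i)%:R)) => [|a _]; last first.
  by rewrite /f nth_cat size_expand mb ltnNge leq_addr /= addKn (@nth_nseq _ _ r.+1) ltnSn.
rewrite (bigD1 i) //= eqxx mulr1 big1 ?addr0 // => a /negPf ->.
by rewrite mulr0.
Qed.

End Blocks.

(** * The exploration algorithm and its law for a fixed table *)

Section Algorithm.
Context {R : realType} {K : nat}.
Variables (i0 : 'I_K) (N Nb Q : nat).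
Variables (g : 'I_K -> 'I_K) (h : 'I_K -> nat -> 'I_K).
Variable (alpha : 'I_K -> nat -> {ffun 'I_K -> N.-tuple bool} -> R).
Variable (q : nat -> R).
Hypothesis i0_eq0 : i0 = 0%N :> nat.
Hypothesis N_gt0 : (0 < N)%N.
Hypothesis Nb_le : (Nb <= N)%N.
Hypothesis Q_gt0 : (0 < Q)%N.
Hypothesis alpha01 : forall j n y, 0 <= alpha j n y <= 1.
Hypothesis g_neq : forall j : 'I_K, (0 < j)%N -> g j != j.
Hypothesis q01 : forall n, 0 <= q n <= 1.
Hypothesis q_mono : forall n, q n <= q n.+1.
Hypothesis q1 : q 1 = 0.
Hypothesis qQ : q Q = 1.

(** Block 0 plays [i0]; the phase of arm [j >= 1] occupies the blocks from [(j - 1) * Q + 1] to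
    [j * Q]. *)
Definition phase_start (j : nat) : nat := (j.-1 * Q).+1.
Definition phase_arm (b : nat) : 'I_K := insubd i0 (b.-1 %/ Q).+1.
Definition phase_step (b : nat) : nat := b.-1 %% Q.

(* Junk value 0 when [q n = 1], in which case exploration has surely occurred. *)
Definition explore_prob (n : nat) : R := (q n.+1 - q n) / (1 - q n).

Definition coin (c : R) (i j a : 'I_K) : R := c * (a == i)%:R + (1 - c) * (a == j)%:R.

(** The membership test is the event [U]. It looks only at the current phase: [h] may have
    recommended [j] in an earlier phase on the basis of test samples, which would spoil the law of
    [U]. *)
Definition explore_dec (m : seq 'I_K) (X : 'I_K -> nat -> bool) : 'I_K -> R :=
  let b := size m in
  if b == 0%N then coin 1 i0 i0 else
  let j := phase_arm b in let n := phase_step b in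
  if n == 0%N then coin (zeros_seen j Nb X)%:R j (g j)
  else if j \in drop (phase_start j) m then coin (alpha j n (batch_seen N j X)) j (h j n)
  else coin (explore_prob n) j (g j).

Lemma coin_sum1 c i j : \sum_a coin c i j a = 1.
Proof.
have E k : \sum_(a : 'I_K) (a == k)%:R = 1 :> R.
  by rewrite (bigD1 k) //= eqxx big1 ?addr0 // => a /negPf ->.
by rewrite big_split /= -!mulr_sumr !E; ring.
Qed.

Lemma coin_ge0 c i j a : 0 <= c <= 1 -> 0 <= coin c i j a.
Proof. by move=> /andP[c0 c1]; rewrite addr_ge0 // mulr_ge0 // subr_ge0. Qed.

Lemma explore_prob01 n : 0 <= explore_prob n <= 1.
Proof.
have /andP[_ qn] := q01 n; have /andP[_ qn1] := q01 n.+1; have := q_mono n => qm.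
rewrite /explore_prob divr_ge0 ?subr_ge0 //=.
have [->|qn'] := eqVneq (q n) 1; first by rewrite subrr invr0 mulr0.
have lt_q : 0 < 1 - q n by rewrite subr_gt0 lt_neqAle qn' qn.
by rewrite ler_pdivrMr // mul1r lerD2r.
Qed.

Lemma explore_probE n : explore_prob n * (1 - q n) = q n.+1 - q n.
Proof.
have /andP[_ qn1] := q01 n.+1; have := q_mono n => qm.
have [E|qn'] := eqVneq (q n) 1; last by rewrite divfK // subr_eq0 eq_sym.
by rewrite E subrr mulr0; apply/eqP; rewrite eq_le subr_ge0 subr_le0 qn1 -{1}E qm.
Qed.

Lemma explore_dec_valid m X : (forall i, 0 <= explore_dec m X i) /\ \sum_i explore_dec m X i = 1.
Proof.
rewrite /explore_dec; case: eqP => _.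
  by split=> [i|]; [apply: coin_ge0; rewrite ler01 lexx | exact: coin_sum1].
case: eqP => _.
  by split=> [i|]; [apply: coin_ge0; case: zeros_seen; rewrite ?ler01 lexx | exact: coin_sum1].
case: ifP => _; split=> [i|]; rewrite ?coin_sum1 //; apply: coin_ge0.
  exact: alpha01.
exact: explore_prob01.
Qed.

Lemma phaseP (j : 'I_K) n : (0 < j)%N -> (n < Q)%N ->
  phase_arm (phase_start j + n) = j /\ phase_step (phase_start j + n) = n.
Proof.
move=> j0 nQ; rewrite /phase_arm /phase_step /phase_start addSn /=.
rewrite divnMDl // divn_small // addn0 modnMDl modn_small // prednK //.
by split => //; apply: val_inj; rewrite val_insubd ltn_ord.
Qed.

Lemma phase_decomp b : (0 < b < (K.-1 * Q).+1)%N ->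
  exists (j : 'I_K) n, [/\ (0 < j)%N, (n < Q)%N & b = (phase_start j + n)%N].
Proof.
case: b => [//|b] /andP[_]; rewrite ltnS => bK.
have K0 : (0 < K)%N by rewrite (leq_ltn_trans _ (ltn_ord i0)).
have jK : ((b %/ Q).+1 < K)%N.
  by rewrite -[K]prednK // ltnS ltn_divLR.
exists (Ordinal jK), (b %% Q)%N; rewrite /phase_start ltn_mod Q_gt0 /=; split => //.
by rewrite addSn -divn_eq.
Qed.

Section FixedTable.
Context {T : nat}.
Variable (x : table K T).
Local Notation L := (N + N)%N.
Local Notation B := (K.-1 * Q).+1.
Local Notation decx := (dec_at L explore_dec x).
Local Notation blockE := (blockE L explore_dec x).

(** After [i * Q + 1] blocks the phase of arm [i] is over. The second clause is what propagates
    inside a phase; at [n = Q] it contradicts [q Q = 1] unless [j] has been played, which yields the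
    first clause for [j]. *)
Definition phase_inv (m : seq 'I_K) : Prop :=
  (forall i : 'I_K, (i * Q < size m)%N -> i \in m) /\
  (forall (j : 'I_K) n, (0 < j)%N -> size m = (phase_start j + n)%N -> (0 < n <= Q)%N ->
     j \notin drop (phase_start j) m -> q n < 1).

Lemma drop_rcons_start (m : seq 'I_K) a j n : size m = (phase_start j + n)%N ->
  drop (phase_start j) (rcons m a) = rcons (drop (phase_start j) m) a.
Proof. by move=> mE; rewrite drop_rcons // mE leq_addr. Qed.

Lemma decxE m (j : 'I_K) n : (0 < j)%N -> (n < Q)%N -> size m = (phase_start j + n)%N ->
  decx m = let X := history_view (hist x (expand L m)) in
    if n == 0%N then coin (zeros_seen j Nb X)%:R j (g j)
    else if j \in drop (phase_start j) m then coin (alpha j n (batch_seen N j X)) j (h j n)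
    else coin (explore_prob n) j (g j).
Proof.
move=> j0 nQ mE; rewrite /dec_at /explore_dec mE.
by have [-> ->] := phaseP j0 nQ; rewrite /phase_start addSn.
Qed.

Lemma phase_inv_step m a : (size m < B)%N -> phase_inv m -> decx m a != 0 ->
  phase_inv (rcons m a).
Proof.
move=> mB [inv1 inv2] da.
have inv2' (j : 'I_K) n : (0 < j)%N -> size (rcons m a) = (phase_start j + n)%N ->
    (0 < n <= Q)%N -> j \notin drop (phase_start j) (rcons m a) -> q n < 1.
  case: n => [//|n] j0; rewrite size_rcons addnS => -[mE] /andP[_ nQ].
  rewrite (drop_rcons_start _ mE) mem_rcons in_cons negb_or => /andP[ja jm].
  move: da; rewrite (decxE j0 nQ mE) /=.
  have [->|n0] := eqVneq n 0%N; first by rewrite q1 ltr01.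
  rewrite (negPf jm) /coin [a == j]eq_sym (negPf ja) mulr0 add0r mulf_eq0 negb_or => /andP[en _].
  have qn : q n < 1 by apply: inv2 mE _ jm => //; rewrite lt0n n0 ltnW.
  rewrite lt_neqAle; have /andP[_ ->] := q01 n.+1; rewrite andbT.
  (* If [q n.+1 = 1] while [q n < 1], exploration has probability 1, so a choice other than [j] had
     weight 0. *)
  apply: contraNneq en => qn1; rewrite /explore_prob qn1 divff ?subrr //.
  by rewrite subr_eq0 eq_sym lt_eqF.
split=> // i; rewrite size_rcons ltnS leq_eqVlt => /orP[/eqP iE|/inv1 im]; last first.
  by rewrite mem_rcons in_cons im orbT.
have [i_eq0|i_gt0] := posnP i.
  have m0 : size m = 0%N by rewrite -iE i_eq0.
  move: da; rewrite /dec_at /explore_dec m0 /= /coin subrr mul0r addr0 mul1r.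
  case: (eqVneq a i0) => [-> _|_]; last by rewrite eqxx.
  by rewrite mem_rcons in_cons; apply/orP; left; apply/eqP/val_inj; rewrite /= i0_eq0.
have sE : size (rcons m a) = (phase_start i + Q)%N.
  by rewrite size_rcons -iE /phase_start addSn -{1}(prednK i_gt0) mulSn addnC.
apply: contraT => im; have := inv2' i Q i_gt0 sE; rewrite Q_gt0 leqnn => /(_ isT).
rewrite qQ ltxx; apply; apply: contra im; exact: mem_drop.
Qed.

Lemma phase_inv0 : phase_inv [::].
Proof. by split=> [i|j n _]; rewrite //= /phase_start addSn. Qed.

Lemma blockE_phase b f f' : (b <= B)%N ->
  (forall m, size m = b -> phase_inv m -> f m = f' m) -> blockE b f = blockE b f'.
Proof. by move=> bB; apply: (blockE_inv phase_inv0 phase_inv_step). Qed.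

(** A single block of an arm already reveals both of its batches. *)
Lemma history_view_played m i k : i \in m -> (k < L)%N ->
  history_view (hist x (expand L m)) i k = view x i k.
Proof.
move=> im kL; rewrite history_viewE // count_expand; apply: leq_trans kL _.
by rewrite -{1}[L]mul1n leq_mul2r -has_count has_pred1 im orbT.
Qed.

Lemma zeros_seen_played m (j : 'I_K) n : (0 < j)%N -> size m = (phase_start j + n)%N ->
  phase_inv m -> zeros_seen j Nb (history_view (hist x (expand L m))) = zeros_seen j Nb (view x).
Proof.
move=> j0 mE [inv1 _]; apply: eq_forallb => i.
case: ltnP => //= ij; apply: eq_forallb => k; rewrite history_view_played //.
  apply: inv1; rewrite mE /phase_start addSn ltnS; apply: leq_trans (leq_addr _ _).
  by rewrite leq_mul2r -ltnS prednK // ij orbT.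
by rewrite (leq_trans (ltn_ord k)) // (leq_trans Nb_le) // leq_addr.
Qed.

Lemma batch_seen_played m (j : 'I_K) n : (0 < j)%N -> size m = (phase_start j + n)%N ->
  phase_inv m -> j \in drop (phase_start j) m ->
  batch_seen N j (history_view (hist x (expand L m))) = batch_seen N j (view x).
Proof.
move=> j0 mE [inv1 _] jm; apply/ffunP => i; rewrite !ffunE; case: leqP => // ij.
apply/eq_from_tnth => k; rewrite !tnth_mktuple history_view_played //; last by rewrite ltn_add2l.
move: ij; rewrite leq_eqVlt => /orP[/eqP/val_inj ->|ij]; first exact: mem_drop jm.
apply: inv1; rewrite mE /phase_start addSn ltnS; apply: leq_trans (leq_addr _ _).
by rewrite leq_mul2r -ltnS prednK // ij orbT.
Qed.

Lemma phase_bound (j : 'I_K) n : (0 < j)%N -> (n <= Q)%N -> (phase_start j + n <= B)%N.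
Proof.
move=> j0 nQ; rewrite /phase_start addSn ltnS.
apply: leq_trans (_ : j.-1 * Q + Q <= _)%N; first by rewrite leq_add2l.
rewrite addnC -mulSn prednK // leq_mul2r -ltnS prednK ?ltn_ord ?orbT //.
exact: leq_ltn_trans (ltn_ord j).
Qed.

(** With [e = explore_prob n], one block turns the probability [v] of [U] into [e + (1 - e) * v].
    For [v = q + (1 - q) * u] this replaces [q] by [q + e * (1 - q)], which is the next value of the
    schedule. *)
Lemma explored_prob (j : 'I_K) n : (0 < j)%N -> (0 < n <= Q)%N ->
  blockE (phase_start j + n) (fun m => (j \in drop (phase_start j) m)%:R) =
  q n + (1 - q n) * (zeros_seen j Nb (view x))%:R.
Proof.
move=> j0; elim: n => [//|n IH] /andP[_ nQ].
have nQ' : (phase_start j + n <= B)%N by apply: phase_bound => //; exact: ltnW.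
rewrite addnS blockES; set u := (zeros_seen _ _ _)%:R : R.
have [n0|n_gt0] := posnP n.
  rewrite (@blockE_phase _ _ (fun=> u + 0 * 0)) //; last first.
    move=> m mE invm; rewrite mul0r addr0.
    rewrite (eq_bigr (fun a => decx m a * (a == j)%:R)); last first.
      move=> a _; rewrite (drop_rcons_start _ mE) drop_oversize; last by rewrite mE n0 addn0.
      by rewrite inE eq_sym.
    rewrite (bigD1 j) //= eqxx mulr1 big1 ?addr0; last by move=> a /negPf ->; rewrite mulr0.
    rewrite (decxE j0 nQ mE) n0 /= (zeros_seen_played j0 mE invm) /coin eqxx.
    by rewrite eq_sym (negPf (g_neq j0)) mulr1 mulr0 addr0.
  by rewrite (@blockE_affine _ _ _ _ explore_dec_valid _ x _ u 0 (fun=> 0))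
    mul0r addr0 n0 q1 add0r subr0 mul1r.
rewrite (@blockE_phase _ _ (fun m => explore_prob n +
    (1 - explore_prob n) * (j \in drop (phase_start j) m)%:R)) //; last first.
  move=> m mE invm.
  rewrite (eq_bigr (fun a => decx m a * (j \in rcons (drop (phase_start j) m) a)%:R)); last first.
    by move=> a _; rewrite (drop_rcons_start _ mE).
  have [jm|jm] := boolP (j \in drop (phase_start j) m).
    rewrite (eq_bigr (decx m)) => [|a _]; last by rewrite mem_rcons in_cons jm orbT mulr1.
    by have [_ ->] := explore_dec_valid m (history_view (hist x (expand L m))); rewrite /= mulr1 addrC subrK.
  rewrite (eq_bigr (fun a => decx m a * (a == j)%:R)) => [|a _]; last first.
    by rewrite mem_rcons in_cons (negPf jm) orbF eq_sym.
  rewrite (bigD1 j) //= eqxx mulr1 big1 ?addr0; last by move=> a /negPf ->; rewrite mulr0.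
  rewrite (decxE j0 nQ mE) (negPf jm) gtn_eqF // /coin eqxx eq_sym (negPf (g_neq j0)) /=.
  by ring.
rewrite (blockE_affine _ explore_dec_valid) IH ?n_gt0 ?(ltnW nQ) // -/u.
rewrite (_ : q n.+1 = q n + explore_prob n * (1 - q n)); last by rewrite explore_probE; ring.
ring.
Qed.

(** Off [U] the mass is [(1 - q n) * (1 - u)]; the part [(q n.+1 - q n) * (1 - u)] of it explores
    [j] now and the rest falls back on [g j]. On [U], the test decides between [j] and [h j n]. *)
Definition block_law (j : 'I_K) n (i : 'I_K) : R :=
  let u := (zeros_seen j Nb (view x))%:R in let c := alpha j n (batch_seen N j (view x)) in
  if n == 0%N then u * (i == j)%:R + (1 - u) * (i == g j)%:R
  else ((q n + (1 - q n) * u) * c + (q n.+1 - q n) * (1 - u)) * (i == j)%:R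
     + (q n + (1 - q n) * u) * (1 - c) * (i == h j n)%:R
     + (1 - q n.+1) * (1 - u) * (i == g j)%:R.

Lemma blockE_law (j : 'I_K) n i : (0 < j)%N -> (n < Q)%N ->
  blockE (phase_start j + n) (fun m => decx m i) = block_law j n i.
Proof.
move=> j0 nQ; have nB : (phase_start j + n <= B)%N by apply: phase_bound => //; exact: ltnW.
rewrite /block_law; set u := (zeros_seen _ _ _)%:R : R; set c := alpha _ _ _.
have [n0|n0] := eqVneq n 0%N.
  rewrite (@blockE_phase _ _ (fun=> coin u j (g j) i + 0 * 0)) //.
    by rewrite (@blockE_affine _ _ _ _ explore_dec_valid _ x _ _ 0 (fun=> 0)) mul0r addr0.
  move=> m mE invm; rewrite mul0r addr0 (decxE j0 nQ mE) n0 /=.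
  by rewrite (zeros_seen_played j0 mE invm).
set cj := coin (explore_prob n) j (g j) i; set ch := coin c j (h j n) i.
rewrite (@blockE_phase _ _ (fun m => cj + (ch - cj) * (j \in drop (phase_start j) m)%:R)) //.
  have nQ' : (0 < n <= Q)%N by rewrite lt0n n0 (ltnW nQ).
  rewrite (blockE_affine _ explore_dec_valid) (explored_prob j0 nQ') -/u.
  rewrite /cj /ch /coin.
  rewrite (_ : q n.+1 = q n + explore_prob n * (1 - q n)); last by rewrite explore_probE; ring.
  by ring.
move=> m mE invm; rewrite (decxE j0 nQ mE) (negPf n0) /=; case: ifP => jm.
  by rewrite (batch_seen_played j0 mE invm jm) mulr1 /cj /ch /c; ring.
by rewrite mulr0 addr0.
Qed.

Lemma first_block_law i : blockE 0 (fun m => decx m i) = (i == i0)%:R.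
Proof. by rewrite /= /dec_at /explore_dec /= /coin; ring. Qed.

Lemma all_played : blockE B (fun m => [forall i, N <= count_mem i (expand L m)]%N%:R) = 1.
Proof.
rewrite (@blockE_phase _ _ (fun=> 1 + 0 * 0)) //.
  by rewrite (@blockE_affine _ _ _ _ explore_dec_valid _ x _ _ 0 (fun=> 0)) mul0r addr0.
move=> m mE [inv1 _]; rewrite mul0r addr0; suff -> : [forall i, N <= count_mem i (expand L m)]%N by [].
apply/forallP => i; rewrite count_expand; have : i \in m.
  apply: inv1; rewrite mE ltnS leq_mul2r -ltnS prednK ?ltn_ord ?orbT //.
  exact: leq_ltn_trans (ltn_ord i).
rewrite -has_pred1 has_count => ci; apply: leq_trans (leq_addr N N) _.
by rewrite -{1}[L]mul1n leq_mul2r ci orbT.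
Qed.

End FixedTable.
End Algorithm.

(** * Incentives *)

Lemma exists_argmax {R : realType} {I : finType} (A : pred I) (i0 : I) (f : I -> R) :
  A i0 -> exists2 i, A i & forall k, A k -> f k <= f i.
Proof. by move=> Ai0; case: (@arg_maxP _ R I i0 A f Ai0) => i Ai fi; exists i. Qed.

Section Incentives.
Context {d : measure_display} {Omega : measurableType d} {R : realType}.
Variable (P : probability Omega R).
Context {K : nat}.
Variable (mu : 'I_K -> Omega -> R).
Hypothesis K_gt1 : (1 < K)%N.
Hypothesis mu_meas : forall i, measurable_fun setT (mu i).
Hypothesis mu01 : forall i w, 0 <= mu i w <= 1.
Hypothesis mu_indep : indep_means P mu.
Hypothesis mu_sorted : forall i j : 'I_K, (i <= j)%N -> prior_mean P mu j <= prior_mean P mu i.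
Variable Nb : nat.
Hypothesis Nb_boot : boot_cond P mu Nb.
Implicit Types (a : 'I_K -> R).
Local Notation nice := (nice mu).
Local Notation EE := (EE P mu).
Local Notation m i := (EE (fun a => a i)).
Local Notation Z j := (zeros_prob j Nb).
Local Notation G := (G_pad P mu).

Definition arm0 : 'I_K := Ordinal (ltnW K_gt1).

Lemma m_sorted (i j : 'I_K) : (i <= j)%N -> m j <= m i.
Proof. exact: mu_sorted. Qed.

Lemma Z_nice (j : nat) : nice (Z j).
Proof.
by apply: nice_prod => i; apply: niceX; apply: niceB; [exact: nice_cst | exact: nice_coord].
Qed.

Lemma Z01 (j : nat) a : cube a -> 0 <= Z j a <= 1.
Proof.
move=> ca; have fac i : 0 <= (1 - a i) ^+ Nb <= 1.
  have /andP[a0 a1] := ca i; rewrite exprn_ge0 ?subr_ge0 // exprn_ile1 ?subr_ge0 //.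
  by rewrite gerBl.
apply/andP; split; first by apply: prodr_ge0 => i _; case/andP: (fac i).
by apply: prodr_ile1 => i _; exact: fac.
Qed.

Lemma Z_local (j : nat) (k : 'I_K) a a' : (j <= k)%N ->
  (forall i, i != k -> a i = a' i) -> Z j a = Z j a'.
Proof.
move=> jk aa; apply: eq_bigr => i ij; rewrite aa //.
by apply: contraTneq ij => ->; rewrite -leqNgt.
Qed.

Lemma EsampE M (c : ('I_K -> R) -> R) (f : table K M -> R) :
  Esamp P mu (fun w x => c (mu ^~ w) * f x) =
  EE (fun a => c a * \sum_x bern_table a x * f x).
Proof.
apply: Ex_ext => w; rewrite mulr_sumr; apply: eq_bigr => x _.
by rewrite table_likE; ring.
Qed.

Lemma indE (b : bool) : ind b = b%:R :> R.
Proof. by case: b. Qed.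

Lemma p_bootE : p_boot P mu Nb = EE (Z K.-1).
Proof.
rewrite /p_boot; transitivity (Esamp P mu (fun (w : Omega) (x : table K Nb) =>
    (fun=> 1) (mu ^~ w) * (zeros K.-1 x)%:R)).
  by apply: Ex_ext => w; apply: eq_bigr => x _; rewrite mul1r indE.
rewrite (@EsampE Nb (fun=> 1) (fun x => (zeros K.-1 x)%:R)).
by apply: EE_ext => // a _; rewrite mul1r table_zeros.
Qed.

(** A quotient with zero denominator is 0, so the strict inequality in [boot_cond] also shows that
    the zeros have positive probability. *)
Lemma boot_gain (i j : 'I_K) : (i < j)%N -> 0 < EE (fun a => (a j - a i) * Z j a) /\ 0 < EE (Z j).
Proof.
move=> ij; have := Nb_boot ij; rewrite /condE_zeros.
have -> : Esamp P mu (fun (w : Omega) (x : table K Nb) => (mu j w - mu i w) * ind (zeros j x)) =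
    EE (fun a => (a j - a i) * Z j a).
  transitivity (Esamp P mu (fun (w : Omega) (x : table K Nb) =>
      (fun a => a j - a i) (mu ^~ w) * (zeros j x)%:R)).
    by apply: Ex_ext => w; apply: eq_bigr => x _; rewrite indE.
  rewrite (@EsampE Nb (fun a => a j - a i) (fun x => (zeros j x)%:R)).
  by apply: EE_ext => // a _; rewrite table_zeros.
have -> : Esamp P mu (fun (w : Omega) (x : table K Nb) => ind (zeros j x)) = EE (Z j).
  transitivity (Esamp P mu (fun (w : Omega) (x : table K Nb) =>
      (fun=> 1) (mu ^~ w) * (zeros j x)%:R)).
    by apply: Ex_ext => w; apply: eq_bigr => x _; rewrite mul1r indE.
  rewrite (@EsampE Nb (fun=> 1) (fun x => (zeros j x)%:R)).
  by apply: EE_ext => // a _; rewrite mul1r table_zeros.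
have Z0 : 0 <= EE (Z j) by apply: EE_ge0 => //; [exact: Z_nice | move=> a /(Z01 j)/andP[]].
move=> h; have Zpos : 0 < EE (Z j).
  rewrite lt_neqAle Z0 andbT; apply: contraTneq h => <-.
  by rewrite invr0 mulr0 ltxx.
by move: h; rewrite pmulr_lgt0 ?invr_gt0.
Qed.

Lemma EZ_gt0 (j : 'I_K) : (0 < j)%N -> 0 < EE (Z j).
Proof. by move=> j0; have [] := @boot_gain arm0 j j0. Qed.

Lemma EZ_le1 (j : nat) : EE (Z j) <= 1.
Proof.
rewrite -(EE_cst P mu 1); apply: EE_le => //; [exact: Z_nice | exact: nice_cst |].
by move=> a /(Z01 j)/andP[].
Qed.

Lemma p_boot_gt0 : 0 < p_boot P mu Nb.
Proof.
have jK : (K.-1 < K)%N by rewrite ltn_predL (ltnW K_gt1).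
rewrite p_bootE; apply: (@EZ_gt0 (Ordinal jK)) => /=.
by case: K K_gt1 => [|[]].
Qed.

Lemma p_boot_le (j : 'I_K) : p_boot P mu Nb <= EE (Z j).
Proof.
rewrite p_bootE; apply: EE_le => //; [exact: Z_nice | exact: Z_nice |] => a ca.
have jK : (j <= K.-1)%N by rewrite -ltnS prednK ?ltn_ord // ltnW.
have fac i : 0 <= (1 - a i) ^+ Nb <= 1.
  have /andP[a0 a1] := ca i; rewrite exprn_ge0 ?subr_ge0 // exprn_ile1 ?subr_ge0 //.
  by rewrite gerBl.
rewrite /zeros_prob [leLHS](bigID (fun i : 'I_K => (i < j)%N)) /=.
rewrite (eq_bigl (fun i : 'I_K => (i < j)%N)); last first.
  move=> i; case: (ltnP i j) => ij; rewrite ?andbF // andbT.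
  by rewrite (leq_trans ij jK).
apply: ler_piMr; first by apply: prodr_ge0 => i _; case/andP: (fac i).
by apply: prodr_ile1 => i _; exact: fac.
Qed.

Lemma p_boot_le1 : p_boot P mu Nb <= 1.
Proof. by rewrite p_bootE EZ_le1. Qed.

Lemma EE_coord_factor (k : 'I_K) W : nice W ->
  (forall a a', (forall i, i != k -> a i = a' i) -> W a = W a') ->
  EE (fun a => a k * W a) = m k * EE W.
Proof.
move=> nW Wk; apply: (EE_factor mu_meas mu01 mu_indep (k := k)) => //; first exact: nice_coord.
by move=> a a' _ _ aa; exact: Wk.
Qed.

Lemma EE_diff_factor (j k : 'I_K) W : nice W ->
  (forall a a', (forall i, i != j -> a i = a' i) -> W a = W a') ->
  (forall a a', (forall i, i != k -> a i = a' i) -> W a = W a') ->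
  EE (fun a => (a j - a k) * W a) = (m j - m k) * EE W.
Proof.
move=> nW Wj Wk; rewrite mulrBl -!EE_coord_factor // -EEB //.
- by congr EE; apply/funext => a; rewrite mulrBl.
- by apply: niceM => //; exact: nice_coord.
- by apply: niceM => //; exact: nice_coord.
Qed.

Lemma mixE (j : 'I_K) (q : 'I_K -> R) a : (forall i : 'I_K, (j <= i)%N -> q i = 0) ->
  \sum_i q i * a i = mix j q a.
Proof.
move=> q0; rewrite (bigID (fun i : 'I_K => (i < j)%N)) /= [X in _ + X]big1 ?addr0 //.
by move=> i; rewrite -leqNgt => /q0 ->; rewrite mul0r.
Qed.

Local Notation pad_gap j q := (fun a => Num.max (a j - mix j q a) 0).

Lemma pad_gap_nice j q : nice (pad_gap j q).
Proof.
apply: nice_max0; apply: niceB; first exact: nice_coord.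
by apply: nice_sum => i; apply: niceZ; exact: nice_coord.
Qed.

Definition pad_set : set R := [set g | exists (j : 'I_K) (q : 'I_K -> R),
    [/\ (0 < j)%N, (forall i, 0 <= q i), (forall i : 'I_K, (j <= i)%N -> q i = 0),
        \sum_(i < K) q i = 1 &
        g = Ex P (fun w => Num.max (mu j w - \sum_(i < K) q i * mu i w) 0)]].

Lemma G_padE : G = inf pad_set. Proof. by []. Qed.

Lemma pad_setP g : pad_set g -> exists (j : 'I_K) (q : 'I_K -> R),
  [/\ (0 < j)%N, (forall i, 0 <= q i), (forall i : 'I_K, (j <= i)%N -> q i = 0),
      \sum_(i < K | (i < j)%N) q i = 1 & g = EE (pad_gap j q)].
Proof.
move=> [j [q [j0 q0 qj q1 ->]]]; exists j, q; split => //.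
  rewrite -q1 [RHS](bigID (fun i : 'I_K => (i < j)%N)) /= [X in _ = _ + X]big1 ?addr0 //.
  by move=> i; rewrite -leqNgt => /qj.
by apply: Ex_ext => w; rewrite (mixE _ qj).
Qed.

Lemma G_pad_le (j : 'I_K) (q : 'I_K -> R) : (0 < j)%N -> (forall i, 0 <= q i) ->
  \sum_(i < K | (i < j)%N) q i = 1 -> G <= EE (pad_gap j q).
Proof.
move=> j0 q0 q1; rewrite G_padE; apply: ge_inf.
  exists 0 => g /pad_setP[j' [q' [_ _ _ _ ->]]].
  by apply: EE_ge0 => //; [exact: pad_gap_nice | move=> a _; rewrite le_max lexx orbT].
pose q' (i : 'I_K) : R := if (i < j)%N then q i else 0.
have q'j (i : 'I_K) : (j <= i)%N -> q' i = 0 by rewrite /q' leqNgt => /negPf ->.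
exists j, q'; split => //.
- by move=> i; rewrite /q'; case: ifP.
- by rewrite -q1 [RHS]big_mkcond.
- apply: Ex_ext => w; rewrite (mixE _ q'j); congr (Num.max (_ - _) 0).
  by apply: eq_bigr => i ij; rewrite /q' ij.
Qed.

Lemma pad_set_nonempty : pad_set !=set0.
Proof.
exists (Ex P (fun w => Num.max (mu (Ordinal K_gt1) w - \sum_(i < K) (i == arm0)%:R * mu i w) 0)).
exists (Ordinal K_gt1), (fun i => (i == arm0)%:R); split => //.
- by move=> i i1; case: eqP => // ii; move: i1; rewrite ii.
- by rewrite (bigD1 arm0) //= ?eqxx big1 ?addr0 // => i /negPf ->.
Qed.

(** The positive part of [mu_j - mu_q] is at least [(mu_j - mu_q) * Z j], whose expectation is a
    [q]-average of bootstrap gains. The least of these finitely many gains bounds the infimum,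
    without compactness of the simplex. *)
Lemma G_pad_gt0 : 0 < G.
Proof.
pose f (p : 'I_K * 'I_K) := EE (fun a => (a p.2 - a p.1) * Z p.2 a).
have ord01 : (fun p : 'I_K * 'I_K => (p.1 < p.2)%N) (arm0, Ordinal K_gt1) by [].
case: (@arg_minP _ R _ (arm0, Ordinal K_gt1) (fun p : 'I_K * 'I_K => (p.1 < p.2)%N) f ord01).
move=> p /(@boot_gain p.1 p.2)[fp _] f_min.
apply: lt_le_trans fp _; rewrite G_padE; apply: lb_le_inf; first exact: pad_set_nonempty.
move=> g /pad_setP[j [q [j0 q0 _ q1 ->]]].
apply: le_trans (_ : \sum_(i < K | (i < j)%N) q i * f (i, j) <= _).
  rewrite -/(f p) -[leLHS]mul1r -q1 mulr_suml; apply: ler_sum => i ij.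
  by apply: ler_wpM2l => //; exact: f_min (i, j) ij.
have nf i : nice (fun a => (a j - a i) * Z j a).
  by apply: niceM; [apply: niceB; exact: nice_coord | exact: Z_nice].
rewrite big_mkcond /= (eq_bigr (fun i : 'I_K => EE (fun a => (if (i < j)%N then q i else 0) *
    ((a j - a i) * Z j a)))); last first.
  by move=> i _; rewrite EEZ //; case: ifP => _; rewrite ?mul0r.
rewrite -EE_sum // => [|i]; last exact: niceZ.
apply: EE_le => //; first by apply: nice_sum => i; exact: niceZ.
  exact: pad_gap_nice.
move=> a ca; have /andP[Z0 Z1] := Z01 j ca.
rewrite (_ : \sum_i _ = (a j - mix j q a) * Z j a); last first.
  have aj : a j = \sum_(i < K | (i < j)%N) q i * a j by rewrite -mulr_suml q1 mul1r.
  symmetry; rewrite {1}aj /mix -sumrB mulr_suml big_mkcond.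
  by apply: eq_bigr => i _; case: ifP => _; rewrite ?mul0r //; ring.
by move: (a j - _) => t; case: (leP t 0) => ?; nra.
Qed.

(** For means [x] of the first arm and [y] of the second, the positive part of [y - x] is at most
    [y * (1 - x)]. By independence and the prior order its expectation is at most [m * (1 - m)] with
    [m] the first prior mean. The bound keeps the logarithm of [1 / G] away from 0. *)
Lemma G_pad_le4 : G <= 4^-1.
Proof.
pose q := fun i : 'I_K => (i == arm0)%:R : R; pose arm1 := Ordinal K_gt1.
have q1 : \sum_(i < K | (i < arm1)%N) q i = 1.
  by rewrite (bigD1 arm0) //= /q ?eqxx big1 ?addr0 // => i /andP[_ /negPf ->].
apply: le_trans (@G_pad_le arm1 q _ (fun i => ler0n _ _) q1) _ => //.
have nb : nice (fun a => 1 - a arm0) by apply: niceB; [exact: nice_cst | exact: nice_coord].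
apply: le_trans (_ : EE (fun a => a arm1 * (1 - a arm0)) <= _).
  apply: EE_le => //; [exact: pad_gap_nice | apply: niceM => //; exact: nice_coord |].
  move=> a ca; have -> : mix arm1 q a = a arm0.
    rewrite /mix (bigD1 arm0) //= /q ?eqxx mul1r big1 ?addr0 // => i /andP[_ /negPf ->].
    by rewrite mul0r.
  have /andP[x0 x1] := ca arm0; have /andP[y0 y1] := ca arm1.
  by case: (leP (a arm1 - a arm0) 0) => ?; nra.
rewrite EE_coord_factor //; last by move=> a a' aa; rewrite aa.
rewrite EEB //; [|exact: nice_cst|exact: nice_coord]; rewrite EE_cst.
have h1 : 0 <= m arm0 - m arm1 by rewrite subr_ge0; exact: m_sorted.
have h2 : 0 <= 1 - m arm0.
  rewrite subr_ge0 -(EE_cst P mu 1); apply: EE_le => //; [exact: nice_coord | exact: nice_cst |].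
  by move=> a ca; case/andP: (ca arm0).
have := mulr_ge0 h1 h2; have := sqr_ge0 (m arm0 - 2^-1); rewrite expr2; lra.
Qed.

(** The constant part of the weight uses only [G_pad_le]; the part proportional to [Z j] uses
    Harris' inequality. *)
Lemma pad_gain_mix (j : 'I_K) (q : 'I_K -> R) (c : R) : (0 < j)%N -> (forall i, 0 <= q i) ->
  \sum_(i < K | (i < j)%N) q i = 1 -> 0 <= c <= 1 ->
  G * EE (fun a => c + (1 - c) * Z j a) <= EE (fun a => pad_gap j q a * (c + (1 - c) * Z j a)).
Proof.
move=> j0 q0 q1 /andP[c0 c1]; have nZ := Z_nice j; have ng := pad_gap_nice j q.
have ngZ := niceM ng nZ.
have G_le := G_pad_le j0 q0 q1.
rewrite EED ?EEZ ?EE_cst //; [|exact: nice_cst | exact: niceZ].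
rewrite (_ : (fun a => _) = fun a => c * pad_gap j q a + (1 - c) * (pad_gap j q a * Z j a)); last first.
  by apply/funext => a; ring.
rewrite EED ?EEZ //; [|exact: niceZ | exact: niceZ].
pose r := [seq i : 'I_K <- index_enum 'I_K | (i < j)%N].
have ZE a : Z j a = \prod_(i <- r) (1 - a i) ^+ Nb by rewrite /r big_filter.
have harris : EE (pad_gap j q) * EE (Z j) <= EE (fun a => pad_gap j q a * Z j a).
  rewrite (_ : Z j = fun a => \prod_(i <- r) (fun t => (1 - t) ^+ Nb) (a i)); last first.
    by apply/funext => a; rewrite ZE.
  apply: (@EE_harris _ _ _ P _ mu mu_meas mu01 mu_indep r (fun t => (1 - t) ^+ Nb) (pad_gap j q)) => //.
  - by rewrite filter_uniq // index_enum_uniq.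
  - by move=> i; apply: niceX; apply: niceB; [exact: nice_cst | exact: nice_coord].
  - by move=> t /andP[_ t1]; rewrite exprn_ge0 // subr_ge0.
  - move=> s t s0 st t1; rewrite lerXn2r // ?nnegrE ?subr_ge0 ?lerD2l ?lerN2 //.
    exact: le_trans st t1.
  - move=> k a b _ _; rewrite mem_filter => /andP[kj _] ab abk.
    have jk : j != k by apply: contraTneq kj => ->; rewrite ltnn.
    rewrite (ab _ jk); have : mix j q a <= mix j q b.
      apply: ler_sum => i _; apply: ler_wpM2l => //.
      by have [->|ik] := eqVneq i k; rewrite ?abk // ab.
    by move=> h; case: (leP (b j - mix j q b) 0) => ?; case: (leP (b j - mix j q a) 0) => ?; lra.
have Z0 := EZ_gt0 j0.
have h1 : c * G <= c * EE (pad_gap j q) by exact: ler_wpM2l.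
have h2 : (1 - c) * (G * EE (Z j)) <= (1 - c) * EE (fun a => pad_gap j q a * Z j a).
  apply: ler_wpM2l; first by rewrite subr_ge0.
  by apply: le_trans harris; apply: ler_wpM2r => //; exact: ltW.
by apply: le_trans (lerD h1 h2); rewrite le_eqVlt; apply/orP; left; apply/eqP; ring.
Qed.

End Incentives.

(** * Incentive inequalities for the pieces of the block law *)

Section Incentives.
Context {d : measure_display} {Omega : measurableType d} {R : realType}.
Variable (P : probability Omega R).
Context {K : nat}.
Variable (mu : 'I_K -> Omega -> R).
Hypothesis K_gt1 : (1 < K)%N.
Hypothesis mu_meas : forall i, measurable_fun setT (mu i).
Hypothesis mu01 : forall i w, 0 <= mu i w <= 1.
Hypothesis mu_indep : indep_means P mu.
Hypothesis mu_sorted : forall i j : 'I_K, (i <= j)%N -> prior_mean P mu j <= prior_mean P mu i.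
Variable Nb : nat.
Hypothesis Nb_boot : boot_cond P mu Nb.
Implicit Types (a : 'I_K -> R).
Local Notation nice := (nice mu).
Local Notation EE := (EE P mu).
Local Notation m i := (EE (fun a => a i)).
Local Notation Z j := (zeros_prob j Nb).
Local Notation G := (G_pad P mu).

(** Below [j] this is the bootstrap condition; above [j] the zeros carry no information on either
    arm and the prior order decides. *)
Lemma boot_arm_best (j k : 'I_K) : (0 < j)%N -> 0 <= EE (fun a => (a j - a k) * Z j a).
Proof.
move=> j0; have Z0 := EZ_gt0 K_gt1 mu_meas mu01 Nb_boot j0.
have [kj|jk|/val_inj->] := ltngtP k j.
- by apply: ltW; have [] := boot_gain mu_meas mu01 Nb_boot kj.
- rewrite (EE_diff_factor mu_meas mu01 mu_indep); last first.
  + by move=> a a'; apply: Z_local; exact: ltnW.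
  + by move=> a a'; apply: Z_local.
  + exact: Z_nice.
  by apply: mulr_ge0; [rewrite subr_ge0 (m_sorted mu_sorted) // ltnW | exact: ltW].
- rewrite (_ : (fun a => _) = fun=> 0) ?EE_cst //.
  by apply/funext => a; rewrite subrr mul0r.
Qed.

Lemma compl_nice (j : nat) : nice (fun a => 1 - Z j a).
Proof. by apply: niceB; [exact: nice_cst | exact: Z_nice]. Qed.

(** Take the best lower arm. It also beats the arms from [j] on: on the zeros the first arm has mean
    below [m j], hence below its own prior mean, so off the zeros its mean exceeds its prior mean.
    For [k >= j], [1 - Z j] is independent of arm [k], which keeps its smaller prior mean. *)
Lemma fallback_arm (j : 'I_K) : (0 < j)%N -> exists2 g : 'I_K, (g < j)%N &
  forall k, 0 <= EE (fun a => (a g - a k) * (1 - Z j a)).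
Proof.
move=> j0; have nZ := Z_nice mu_meas Nb j; have nC := compl_nice j.
have ni (i : 'I_K) : nice (fun a => a i * (1 - Z j a)).
  by apply: niceM => //; exact: nice_coord.
have [g gj g_max] := @exists_argmax R _ (fun i : 'I_K => (i < j)%N) (arm0 K_gt1)
  (fun i => EE (fun a => a i * (1 - Z j a))) j0.
exists g => // k.
rewrite (_ : (fun a => _) = fun a => a g * (1 - Z j a) - a k * (1 - Z j a)); last first.
  by apply/funext => a; rewrite mulrBl.
rewrite EEB // subr_ge0; have [kj|jk] := ltnP k j; first exact: g_max.
apply: le_trans (g_max (arm0 K_gt1) j0).
have n0 := nice_coord mu_meas (arm0 K_gt1); have nj := nice_coord mu_meas j.
have n0Z := niceM n0 nZ; have njZ := niceM nj nZ.
rewrite (EE_coord_factor mu_meas mu01 mu_indep) //; last first.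
  by move=> a a' aa; rewrite (Z_local Nb jk aa).
rewrite (_ : (fun a => a (arm0 K_gt1) * _) =
    fun a => a (arm0 K_gt1) - a (arm0 K_gt1) * Z j a); last first.
  by apply/funext => a; ring.
rewrite !EEB //; last exact: nice_cst.
have [boot _] := @boot_gain _ _ _ P _ mu mu_meas mu01 Nb Nb_boot (arm0 K_gt1) j j0.
have bootE : EE (fun a => (a j - a (arm0 K_gt1)) * Z j a) =
    m j * EE (Z j) - EE (fun a => a (arm0 K_gt1) * Z j a).
  rewrite -(EE_coord_factor mu_meas mu01 mu_indep) //; last by move=> a a'; apply: Z_local.
  by rewrite -EEB //; congr EE; apply/funext => a; ring.
rewrite bootE in boot; rewrite EE_cst.
have Z0 := EZ_gt0 K_gt1 mu_meas mu01 Nb_boot j0.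
have Z1 := @EZ_le1 _ _ _ P _ mu mu_meas mu01 Nb j.
have m0k : m k <= m (arm0 K_gt1) by apply: (m_sorted mu_sorted).
have m0j : m j <= m (arm0 K_gt1) by apply: (m_sorted mu_sorted).
nra.
Qed.

Variable N : nat.
Hypothesis N_large : 16 * G ^- 2 <= N%:R.
Local Notation pad_alpha := ({ffun 'I_K -> N.-tuple bool} -> R).
Local Notation A j alpha := (mean_test (@batch_kernel R K N j) alpha).
Local Notation V j c := (fun a => c + (1 - c) * Z j a).

Let G0 : 0 < G. Proof. exact: (@G_pad_gt0 _ _ _ P _ mu K_gt1 mu_meas mu01 Nb Nb_boot). Qed.

Lemma N_gt0 : (0 < N)%N.
Proof.
rewrite -(ltr0n R); apply: lt_le_trans N_large; apply: mulr_gt0 => //.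
by rewrite invr_gt0 exprn_gt0.
Qed.

Lemma batch_kernel_nice (j i k : 'I_K) (y : N.-tuple bool) : nice (fun a => batch_kernel j k (a i) y).
Proof.
rewrite /batch_kernel; case: (k <= j)%N; last exact: nice_cst.
apply: nice_prod => b; rewrite /bern; case: b; first exact: nice_coord.
by apply: niceB; [exact: nice_cst | exact: nice_coord].
Qed.

Lemma batch_kernel_ge0 (j i : 'I_K) (t : R) (y : N.-tuple bool) :
  0 <= t <= 1 -> 0 <= batch_kernel j i t y.
Proof. by move=> t01; rewrite /batch_kernel; case: ifP => _; [exact: bern_seq_ge0 | exact: ler0n]. Qed.

(** With [s = G / 8] in [sample_mean_close], the two terms balance exactly when
    [N = 16 * G ^- 2]. *)
Lemma batch_mean_close (j i : 'I_K) (t : R) : (i <= j)%N -> 0 <= t <= 1 ->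
  \sum_(y : N.-tuple bool) batch_kernel j i t y * `|sample_mean y - t| <= G / 8.
Proof.
move=> ij t01; rewrite /batch_kernel ij.
have s0 : 0 < G / 8 by apply: divr_gt0.
apply: le_trans (sample_mean_close N_gt0 s0 t01) _.
have NG : 16 * G^-1 <= N%:R * G.
  have := N_large; rewrite -(ler_pM2r G0); apply: le_trans.
  by rewrite le_eqVlt; apply/orP; left; apply/eqP; field; rewrite gt_eqF.
have h : (4 * N%:R * (G / 8))^-1 <= G / 8.
  rewrite -[leRHS]invrK lef_pV2 ?posrE; last 2 first.
  - by rewrite !mulr_gt0 // ?ltr0n ?N_gt0 // invr_gt0.
  - by rewrite invr_gt0.
  by rewrite invf_div mulrC; lra.
by lra.
Qed.

Lemma V_nice j c : nice (V j c).
Proof.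
by apply: niceD; [exact: nice_cst | apply: niceZ; exact: Z_nice].
Qed.

Lemma V01 j c a : 0 <= c <= 1 -> cube a -> 0 <= c + (1 - c) * Z j a <= 1.
Proof. by move=> /andP[c0 c1] /(Z01 Nb j)/andP[z0 z1]; apply/andP; split; nra. Qed.

Lemma EV j c : EE (V j c) = c + (1 - c) * EE (Z j).
Proof.
have nZ := Z_nice mu_meas Nb j.
by rewrite EED ?EEZ ?EE_cst //; [exact: nice_cst | exact: niceZ].
Qed.

Lemma A_nice j (alpha : pad_alpha) : nice (A j alpha).
Proof. by apply: mean_test_nice => i k y; exact: batch_kernel_nice. Qed.

(** Masked arms have a kernel that does not depend on their mean. *)
Lemma A_local (j k : 'I_K) (alpha : pad_alpha) a a' : (j < k)%N ->
  (forall i, i != k -> a i = a' i) -> A j alpha a = A j alpha a'.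
Proof.
move=> jk aa; apply: eq_bigr => y _; congr (_ * _); apply: eq_bigr => i _.
have [->|ik] := eqVneq i k; last by rewrite aa.
by rewrite /batch_kernel leqNgt jk.
Qed.

(** From a gain of [G * EE V], estimation takes [2 * (G / 8)] and approachability [G / 4] of [EE V].
    For [k > j] the weight is independent of arm [k], whose mean can be replaced by [m k <= m j];
    the mean inequality of [padded_test] concludes. *)
Lemma padded_phase (j : 'I_K) (c : R) : (0 < j)%N -> 0 <= c <= 1 ->
  exists alpha : pad_alpha, [/\ forall y, 0 <= alpha y <= 1,
    forall i : 'I_K, (i < j)%N ->
      G / 2 * EE (V j c) <= EE (fun a => (a j - a i) * V j c a * A j alpha a) &
    forall k : 'I_K, (j < k)%N -> 0 <= EE (fun a => (a j - a k) * V j c a * A j alpha a)].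
Proof.
move=> j0 c01; have /andP[c0 c1] := c01; have nV := V_nice j c.
have Z0 := EZ_gt0 K_gt1 mu_meas mu01 Nb_boot j0.
have Z1 := @EZ_le1 _ _ _ P _ mu mu_meas mu01 Nb j.
have z0 : 0 <= 1 - EE (Z j) by rewrite subr_ge0.
have c0' : 0 <= 1 - c by rewrite subr_ge0.
have V0 : 0 < EE (V j c) by rewrite EV; have := mulr_ge0 c0 z0; lra.
have V1 : EE (V j c) <= 1 by rewrite EV; have := mulr_ge0 c0' z0; lra.
have G4 := @G_pad_le4 _ _ _ P _ mu K_gt1 mu_meas mu01 mu_indep mu_sorted.
have slack1 : `|G * EE (V j c) - 2 * (G / 8) * EE (V j c)| <= 1.
  rewrite ler_norml; have := mulr_ge0 (ltW G0) (ltW V0).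
  by have := ler_pM (ltW G0) (ltW V0) G4 V1; lra.
have [alpha [alpha01 gain_lt gain_gt]] := @padded_test _ _ _ P _ mu mu_meas mu01 mu_indep
  _ (@batch_kernel R K N j) (@sample_mean R N) (G / 8) j
  (fun i k y => batch_kernel_nice j i k y) (batch_kernel_ge0 j) (batch_kernel_sum1 N j)
  (@batch_mean_close j) (V j c) nV (fun a => @V01 j c a c01)
  (fun a b ab => congr1 (fun z => c + (1 - c) * z) (Z_local Nb (leqnn j) ab))
  (G * EE (V j c)) (G / 4 * EE (V j c)) j0 (mulr_gt0 (divr_gt0 G0 (ltr0n R 4)) V0)
  slack1
  (fun q q0 q1 => pad_gain_mix K_gt1 mu_meas mu01 mu_indep Nb_boot j0 q0 q1 c01).
exists alpha; split => // [i ij|k jk].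
  by apply: le_trans (gain_lt i ij); rewrite le_eqVlt; apply/orP; left; apply/eqP; field.
have nA := A_nice j alpha; have nVA := niceM nV nA.
have nj := nice_coord mu_meas j; have nk := nice_coord mu_meas k.
have nVAj := niceM nj nVA; have nVAk := niceM nk nVA.
have kE : EE (fun a => a k * (V j c a * A j alpha a)) = m k * EE (fun a => V j c a * A j alpha a).
  apply: (EE_coord_factor mu_meas mu01 mu_indep) => // a a' aa.
  by rewrite (Z_local Nb (ltnW jk) aa) (A_local _ jk aa).
have VA0 : 0 <= EE (fun a => V j c a * A j alpha a).
  apply: EE_ge0 => // a ca; apply: mulr_ge0; first by case/andP: (V01 j c01 ca).
  have /andP[] := mean_test01 (batch_kernel_ge0 j) (batch_kernel_sum1 N j) alpha01 ca.
  by [].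
move: gain_gt; rewrite (_ : (fun a => (a j - _) * _ * _) =
    fun a => a j * (V j c a * A j alpha a) - m j * (V j c a * A j alpha a)); last first.
  by apply/funext => a; ring.
rewrite EEB ?EEZ //; last exact: niceZ.
rewrite (_ : (fun a => (a j - a k) * _ * _) =
    fun a => a j * (V j c a * A j alpha a) - a k * (V j c a * A j alpha a)); last first.
  by apply/funext => a; ring.
rewrite EEB // kE; have := ler_wpM2r VA0 (m_sorted mu_sorted (ltnW jk)); lra.
Qed.

Lemma phase_policy (j : 'I_K) (c c' : R) : (0 < j)%N -> 0 <= c -> c <= c' -> c' <= 1 ->
  c' - c <= G / 2 * EE (V j c) ->
  exists (alpha : pad_alpha) (h : 'I_K), [/\ forall y, 0 <= alpha y <= 1,
    forall k, 0 <= EE (fun a => (a j - a k) *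
      (V j c a * A j alpha a + (c' - c) * (1 - Z j a))) &
    forall k, 0 <= EE (fun a => (a h - a k) * (V j c a * (1 - A j alpha a)))].
Proof.
move=> j0 c0 cc' c'1 slack; have c01 : 0 <= c <= 1 by rewrite c0 (le_trans cc').
have [alpha [alpha01 gain_lt gain_gt]] := padded_phase j0 c01.
have nV := V_nice j c; have nA := A_nice j alpha; have nC := compl_nice j.
have nW : nice (fun a => V j c a * (1 - A j alpha a)).
  by apply: niceM => //; apply: niceB => //; exact: nice_cst.
have ni (i : 'I_K) : nice (fun a => a i * (V j c a * (1 - A j alpha a))).
  by apply: niceM => //; exact: nice_coord.
have [h _ h_max] := @exists_argmax R _ xpredT j
  (fun i => EE (fun a => a i * (V j c a * (1 - A j alpha a)))) isT.
exists alpha, h; split => // k; last first.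
  rewrite (_ : (fun a => _) = fun a => a h * (V j c a * (1 - A j alpha a)) -
    a k * (V j c a * (1 - A j alpha a))); last by apply/funext => a; rewrite mulrBl.
  by rewrite EEB // subr_ge0 h_max.
have nD : nice (fun a => a j - a k) by apply: niceB; exact: nice_coord.
have nDVA : nice (fun a => (a j - a k) * V j c a * A j alpha a) by do 2!apply: niceM => //.
have nDC : nice (fun a => (a j - a k) * (1 - Z j a)) by exact: niceM.
rewrite (_ : (fun a => _) = fun a => (a j - a k) * V j c a * A j alpha a +
    (c' - c) * ((a j - a k) * (1 - Z j a))); last by apply/funext => a; ring.
rewrite EED ?EEZ //; last exact: niceZ.
have c'c : 0 <= c' - c by rewrite subr_ge0.
have [kj|jk|/val_inj->] := ltngtP k j.
(* Forced exploration loses at most 1 per unit of mass, which the surplus on [U] covers. *)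
- have : -1 <= EE (fun a => (a j - a k) * (1 - Z j a)).
    rewrite -(EE_cst P mu (-1)); apply: EE_le => //; first exact: nice_cst.
    move=> a ca; have /andP[z0 z1] := Z01 Nb j ca.
    have /andP[x0 x1] := ca j; have /andP[y0 y1] := ca k; nra.
  by move=> /(ler_wpM2l c'c); have := gain_lt k kj; lra.
(* Against an arm above [j], exploration is harmless: [Z j] involves neither arm. *)
- rewrite addr_ge0 ?gain_gt // mulr_ge0 // (EE_diff_factor mu_meas mu01 mu_indep) //; last first.
  + by move=> a a' aa; rewrite (Z_local Nb (ltnW jk) aa).
  + by move=> a a' aa; rewrite (Z_local Nb (leqnn j) aa).
  rewrite mulr_ge0 //; first by rewrite subr_ge0 (m_sorted mu_sorted) // ltnW.
  by apply: EE_ge0 => // a ca; rewrite subr_ge0; case/andP: (Z01 Nb j ca).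
- rewrite (_ : (fun a => _) = fun=> 0); last by apply/funext => a; rewrite subrr !mul0r.
  rewrite (_ : (fun a => _ * (1 - _)) = fun=> 0); last by apply/funext => a; rewrite subrr !mul0r.
  by rewrite EE_cst mulr0 addr0.
Qed.

End Incentives.

(** * Assembling the algorithm *)

Section Schedule.
Context {R : realType}.
Variables (p lam : R).
Hypotheses (p_gt0 : 0 < p) (p_le1 : p <= 1) (lam_gt0 : 0 < lam) (lam_le1 : lam <= 1).

(* Index 1 is the state right after the first block of a phase. *)
Definition schedule (n : nat) : R := Num.min 1 (p * ((1 + lam) ^+ n.-1 - 1)).

Lemma schedule01 n : 0 <= schedule n <= 1.
Proof.
rewrite /schedule ge_min lexx andbT le_min ler01 /=; apply: mulr_ge0; first exact: ltW.
by rewrite subr_ge0 exprn_ege1 // lerDl (ltW lam_gt0).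
Qed.

Lemma schedule1 : schedule 1 = 0.
Proof. by rewrite /schedule /= expr0 subrr mulr0; apply/min_idPr. Qed.

Lemma schedule_mono n : schedule n <= schedule n.+1.
Proof.
rewrite /schedule le_min ge_min lexx /= ge_min; apply/orP; right.
rewrite ler_pM2l // lerD2r; case: n => [//|n] /=.
have lam1 : 1 <= 1 + lam by rewrite lerDl (ltW lam_gt0).
by rewrite exprS ler_peMl // exprn_ge0 // (le_trans ler01).
Qed.

(** Before saturation the increment is at most [lam * (y + p)] with [y = schedule n], while [y + (1
    - y) * z >= y + p - y * p >= (y + p) / 2]. This is where the factor 2 comes from. *)
Lemma schedule_step n z : (0 < n)%N -> p <= z -> z <= 1 ->
  schedule n.+1 - schedule n <= 2 * lam * (schedule n + (1 - schedule n) * z).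
Proof.
case: n => [//|n] _ pz z1; rewrite /schedule /= exprS.
have e1 : 1 <= (1 + lam) ^+ n by rewrite exprn_ege1 // lerDl (ltW lam_gt0).
move: ((1 + lam) ^+ n) e1 => e e1.
set y := p * (e - 1); have -> : p * ((1 + lam) * e - 1) = y + lam * (y + p) by rewrite /y; ring.
have y0 : 0 <= y by rewrite /y mulr_ge0 ?subr_ge0 // (ltW p_gt0).
have yp : 0 <= lam * (y + p) by rewrite mulr_ge0 ?addr_ge0 ?(ltW p_gt0) ?(ltW lam_gt0).
have [y1|y1] := leP 1 y.
  have -> : Num.min 1 (y + lam * (y + p)) = 1 by apply/min_idPl; lra.
  by rewrite !subrr mul0r addr0 mulr1 mulr_ge0 // (ltW lam_gt0).
have h1 : Num.min 1 (y + lam * (y + p)) <= y + lam * (y + p) by rewrite ge_min lexx orbT.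
apply: le_trans (lerB h1 (lexx y)) _; rewrite addrAC subrr add0r -[2 * lam]mulrC -mulrA.
rewrite ler_pM2l //; have : 0 <= (1 - y) * (z - p) by rewrite mulr_ge0 // subr_ge0 // (ltW y1).
have : 0 <= y * (1 - p) by rewrite mulr_ge0 // subr_ge0.
have : 0 <= p * (1 - y) by rewrite mulr_ge0 ?subr_ge0 ?(ltW p_gt0) ?(ltW y1).
lra.
Qed.

(** It suffices that [(1 + lam) ^+ Q.-1 >= 2 / p], since then [p * (2 / p - 1) = 2 - p >= 1]. As
    [lam <= 1], [1 + lam >= expR (lam / 2)] turns this into a logarithmic number of steps. *)
Lemma schedule_end : exists Q : nat,
  [/\ (0 < Q)%N, schedule Q = 1 & Q%:R <= 2 * ln (2 / p) / lam + 2].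
Proof.
pose M := (Num.truncn (2 * ln (2 / p) / lam)).+1; exists M.+1.
have p2 : 1 <= 2 / p by rewrite ler_pdivlMr // mul1r; have := p_le1; lra.
have ln0 : 0 <= 2 * ln (2 / p) / lam.
  by rewrite divr_ge0 ?(ltW lam_gt0) // mulr_ge0 // ln_ge0.
have lM : 2 * ln (2 / p) / lam < M%:R by exact: truncnS_gt.
have Ml : M%:R <= 2 * ln (2 / p) / lam + 1.
  by rewrite /M -natr1 lerD2r truncn_le.
split => //; last by rewrite -natr1; lra.
apply/min_idPl; rewrite /=.
have e1 : expR (lam / 2) <= 1 + lam.
  have h := expR_ge1Dx (- (lam / 2)).
  have h' : 0 < 1 + - (lam / 2) by have := lam_le1; lra.
  have e0 := expR_gt0 (lam / 2).
  rewrite expRN in h; have := ler_wpM2r (ltW e0) h; rewrite mulVf ?gt_eqF // => h2.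
  have := lam_gt0; have := lam_le1; nra.
have : 2 / p <= (1 + lam) ^+ M.
  apply: le_trans (_ : expR (lam / 2) ^+ M <= _); last first.
    by rewrite lerXn2r // nnegrE ?expR_ge0 // addr_ge0 // (ltW lam_gt0).
  rewrite -expRM_natl -[leLHS]lnK ?posrE ?divr_gt0 // ler_expR.
  move: lM; rewrite ltr_pdivrMr // => lM; lra.
rewrite ler_pdivrMr // => h; rewrite mulrBr mulr1; have := p_le1; lra.
Qed.

End Schedule.

Section RunExpectation.
Context {d : measure_display} {Omega : measurableType d} {R : realType}.
Variable (P : probability Omega R).
Context {K : nat}.
Variables (mu : 'I_K -> Omega -> R) (i0 : 'I_K).

Lemma ErunE T (pi : policy (R := R) K) (c : ('I_K -> R) -> R) (f : seq 'I_K -> R) :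
  Erun (T := T) P mu pi (fun w _ s => c (mu ^~ w) * f s) =
  EE P mu (fun a => c a * \sum_(x : table K T) bern_table a x * runE pi x T f).
Proof.
apply: Ex_ext => w; rewrite mulr_sumr; apply: eq_bigr => x _.
rewrite -(sum_traj_weight pi x i0) mulr_sumr mulr_sumr; apply: eq_bigr => s _.
by rewrite table_likE; ring.
Qed.

End RunExpectation.

(** * Block law averaged over the samples *)

Section BlockLaw.
Context {R : realType} {K : nat}.
Variables (N Nb : nat) (g : 'I_K -> 'I_K) (h : 'I_K -> nat -> 'I_K).
Variable (alpha : 'I_K -> nat -> {ffun 'I_K -> N.-tuple bool} -> R).
Variable (q : nat -> R) (r : nat).
Hypothesis Nb_le : (Nb <= N)%N.
Local Notation T := (N + (N + r))%N.
Local Notation Z j a := (zeros_prob j Nb a).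
Local Notation A j n a := (mean_test (@batch_kernel R K N j) (alpha j n) a).

(** The law is a combination of [1], [u], [c] and [u * c], so four averages suffice; that of [c]
    alone comes from [table_batches] with an empty zeros condition. *)
Lemma sum_block_law (j i : 'I_K) n (a : 'I_K -> R) :
  \sum_(x : table K T) bern_table a x * block_law Nb g h alpha q x j n i =
  if n == 0%N then Z j a * (i == j)%:R + (1 - Z j a) * (i == g j)%:R
  else ((q n + (1 - q n) * Z j a) * A j n a + (q n.+1 - q n) * (1 - Z j a)) * (i == j)%:R
     + (q n + (1 - q n) * Z j a) * (1 - A j n a) * (i == h j n)%:R
     + (1 - q n.+1) * (1 - Z j a) * (i == g j)%:R.
Proof.
pose u (x : table K T) : R := (zeros_seen j Nb (view x))%:R.
pose c (x : table K T) : R := alpha j n (batch_seen N j (view x)).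
have mean1 : mean_test (@batch_kernel R K N j) (fun=> 1) a = 1.
  rewrite /mean_test; under eq_bigr do rewrite mulr1.
  exact: (lik_sum1 (batch_kernel_sum1 N j)).
have Su : \sum_x bern_table a x * u x = Z j a.
  rewrite -[RHS]mulr1 -mean1 -(table_batches r j j a _ Nb_le).
  by apply: eq_bigr => x _; rewrite mulr1.
have Suc : \sum_x bern_table a x * (u x * c x) = Z j a * A j n a.
  exact: table_batches.
have Sc : \sum_x bern_table a x * c x = A j n a.
  have -> : A j n a = Z 0%N a * A j n a by rewrite /zeros_prob big_pred0 ?mul1r.
  rewrite -(table_batches r 0 j a _ Nb_le); apply: eq_bigr => x _.
  by rewrite (_ : zeros_seen 0 Nb (view x)) ?mul1r //; apply/forallP.
have lin c0 c1 c2 c3 : \sum_x bern_table a x * (c0 + c1 * u x + c2 * c x + c3 * (u x * c x)) =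
    c0 + c1 * Z j a + c2 * A j n a + c3 * (Z j a * A j n a).
  rewrite -Suc -Sc -Su -[in RHS](mulr1 c0) -(bern_table_sum1 T a) !mulr_sumr -!big_split /=.
  by apply: eq_bigr => x _; ring.
rewrite /block_law; case: ifP => _.
  transitivity (\sum_x bern_table a x * ((i == g j)%:R + ((i == j)%:R - (i == g j)%:R) * u x
      + 0 * c x + 0 * (u x * c x))).
    by apply: eq_bigr => x _; congr (_ * _); rewrite -/(u x); ring.
  by rewrite lin; ring.
transitivity (\sum_x bern_table a x *
   (((q n.+1 - q n) * (i == j)%:R + q n * (i == h j n)%:R + (1 - q n.+1) * (i == g j)%:R)
   + (- (q n.+1 - q n) * (i == j)%:R + (1 - q n) * (i == h j n)%:R
      - (1 - q n.+1) * (i == g j)%:R) * u x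
   + (q n * (i == j)%:R - q n * (i == h j n)%:R) * c x
   + ((1 - q n) * (i == j)%:R - (1 - q n) * (i == h j n)%:R) * (u x * c x))).
  by apply: eq_bigr => x _; congr (_ * _); rewrite -/(u x) -/(c x); ring.
by rewrite lin; ring.
Qed.

End BlockLaw.

(** * Incentive compatibility and number of rounds *)

Section Construction.
Context {d : measure_display} {Omega : measurableType d} {R : realType}.
Variable (P : probability Omega R).
Context {K : nat}.
Variable (mu : 'I_K -> Omega -> R).
Hypothesis K_gt1 : (1 < K)%N.
Hypothesis mu_meas : forall i, measurable_fun setT (mu i).
Hypothesis mu01 : forall i w, 0 <= mu i w <= 1.
Hypothesis mu_indep : indep_means P mu.
Hypothesis mu_sorted : forall i j : 'I_K, (i <= j)%N -> prior_mean P mu j <= prior_mean P mu i.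
Variables Nb N : nat.
Hypothesis Nb_boot : boot_cond P mu Nb.
Hypothesis Nb_le : (Nb <= N)%N.
Local Notation EE := (EE P mu).
Local Notation nice := (nice mu).
Local Notation G := (G_pad P mu).
Local Notation p := (p_boot P mu Nb).
Hypothesis N_large : 16 * G ^- 2 <= N%:R.
Local Notation Z j := (zeros_prob j Nb).
Local Notation q := (schedule p (G / 4)).
Local Notation V j n := (fun a => q n + (1 - q n) * Z j a).
Local Notation A j alpha := (mean_test (@batch_kernel R K N j) alpha).

Let G0 : 0 < G. Proof. exact: (@G_pad_gt0 _ _ _ P _ mu K_gt1 mu_meas mu01 Nb Nb_boot). Qed.
Let G4 : G <= 4^-1. Proof. exact: (@G_pad_le4 _ _ _ P _ mu K_gt1). Qed.
Let p0 : 0 < p. Proof. exact: p_boot_gt0. Qed.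
Let p1 : p <= 1. Proof. exact: p_boot_le1. Qed.
Let N0 : (0 < N)%N. Proof. exact: (@N_gt0 _ _ _ P _ mu K_gt1 mu_meas mu01 Nb Nb_boot N N_large). Qed.
Let lam0 : 0 < G / 4. Proof. by have := G0; lra. Qed.
Let lam1 : G / 4 <= 1. Proof. by have := G4; lra. Qed.

Lemma exists_phase_policies : exists (alpha : 'I_K -> nat -> {ffun 'I_K -> N.-tuple bool} -> R)
    (h : 'I_K -> nat -> 'I_K), (forall j n y, 0 <= alpha j n y <= 1) /\
  forall (j : 'I_K) n, (0 < j)%N -> (0 < n)%N -> (forall k, 0 <= EE (fun a => (a j - a k) *
      (V j n a * A j (alpha j n) a + (q n.+1 - q n) * (1 - Z j a)))) /\
    (forall k, 0 <= EE (fun a => (a (h j n) - a k) * (V j n a * (1 - A j (alpha j n) a)))).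
Proof.
have pointwise (s : 'I_K * nat) : exists f : ({ffun 'I_K -> N.-tuple bool} -> R) * 'I_K,
    (forall y, 0 <= f.1 y <= 1) /\ ((0 < s.1)%N -> (0 < s.2)%N ->
    (forall k, 0 <= EE (fun a => (a s.1 - a k) *
      (V s.1 s.2 a * A s.1 f.1 a + (q s.2.+1 - q s.2) * (1 - Z s.1 a)))) /\
    (forall k, 0 <= EE (fun a => (a f.2 - a k) * (V s.1 s.2 a * (1 - A s.1 f.1 a))))).
  case: s => j n /=; have [j0|j0] := posnP j.
    by exists (fun=> 0, j); split=> [y|]; rewrite ?lexx ?ler01.
  have [n0|n0] := posnP n; first by exists (fun=> 0, j); split=> [y|_]; rewrite ?lexx ?ler01.
  have /andP[q0 _] := schedule01 p0 lam0 n; have /andP[_ q1] := schedule01 p0 lam0 n.+1.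
  (* The rate [G / 4] is chosen so that twice it equals the surplus constant [G / 2]. *)
  have slack : q n.+1 - q n <= G / 2 * EE (V j n).
    rewrite EV // (_ : G / 2 = 2 * (G / 4)); last by field.
    apply: schedule_step => //; first exact: p_boot_le.
    exact: EZ_le1.
  have [alpha [h [h1 h2 h3]]] := @phase_policy _ _ _ P _ mu K_gt1 mu_meas mu01 mu_indep mu_sorted
    Nb Nb_boot N N_large j (q n) (q n.+1) j0 q0 (schedule_mono p0 lam0 n) q1 slack.
  by exists (alpha, h).
have [f Hf] := choice pointwise.
exists (fun j n => (f (j, n)).1), (fun j n => (f (j, n)).2).
by split=> [j n|j n]; [exact: (Hf (j, n)).1 | exact: (Hf (j, n)).2].
Qed.

Lemma exists_fallback : exists g : 'I_K -> 'I_K, forall j : 'I_K, (0 < j)%N ->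
  (g j < j)%N /\ forall k, 0 <= EE (fun a => (a (g j) - a k) * (1 - Z j a)).
Proof.
suff pointwise (j : 'I_K) : exists g : 'I_K, (0 < j)%N ->
    (g < j)%N /\ forall k, 0 <= EE (fun a => (a g - a k) * (1 - Z j a)).
  by have [g Hg] := choice pointwise; exists g.
have [j0|j0] := posnP j; first by exists j.
have [g gj Hg] := @fallback_arm _ _ _ P _ mu K_gt1 mu_meas mu01 mu_indep mu_sorted Nb Nb_boot j j0.
by exists g.
Qed.

(* The rounds are those of [1 + (K - 1) Q] blocks of length [2 N], written so
   that the two batches of each arm are apparent. *)
Lemma exists_bic_policy (Q : nat) : (0 < Q)%N -> q Q = 1 ->
  let T := (N + (N + K.-1 * Q * (N + N)))%N in
  exists pi : policy K, [/\ valid_policy pi, BIC P mu T pi & collects P mu T pi N].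
Proof.
move=> Q0 qQ T.
have [alpha [h [alpha01 Halpha]]] := exists_phase_policies.
have [g Hg] := exists_fallback.
pose i0 := arm0 K_gt1.
have i00 : i0 = 0%N :> nat by [].
have g_neq (j : 'I_K) : (0 < j)%N -> g j != j.
  by move=> j0; have [gj _] := Hg j j0; apply: contraTneq gj => ->; rewrite ltnn.
have q01 := schedule01 p0 lam0; have q_mono := schedule_mono p0 lam0.
have q1 : q 1 = 0 := schedule1 p (G / 4).
pose dec := explore_dec i0 Nb Q g h alpha q.
have dec_valid m X : (forall i, 0 <= dec m X i) /\ \sum_i dec m X i = 1.
  exact: explore_dec_valid.
have L0 : (0 < N + N)%N by rewrite addn_gt0 N0.
have TE : T = ((K.-1 * Q).+1 * (N + N))%N by rewrite /T mulSn addnA.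
pose pi := block_policy i0 (N + N) dec.
have pi_valid : valid_policy pi by exact: block_policy_valid.
have nC j : nice (fun a => 1 - Z j a) by exact: compl_nice.
have nZ j : nice (Z j) by exact: Z_nice.
have nA j n : nice (A j (alpha j n)) by exact: A_nice.
have nV j n : nice (V j n) by exact: V_nice.
have nd i k : nice (fun a => a i - a k) by apply: niceB; exact: nice_coord.
exists pi; split => //; last first.
  rewrite /collects.
  pose f (u : seq 'I_K) : R := [forall i, N <= count_mem i u]%N%:R.
  transitivity (Erun (T := T) P mu pi (fun _ _ s => 1 * f s)).
    apply: Ex_ext => w; apply: eq_bigr => x _; apply: eq_bigr => s _.
    by rewrite mul1r indE.
  rewrite (@ErunE _ _ _ P _ mu i0 T pi (fun=> 1) f) -[RHS](EE_cst P mu 1); congr EE; apply/funext => a.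
  rewrite mul1r -[RHS](bern_table_sum1 T a); apply: eq_bigr => x _.
  suff run1 n : n = ((K.-1 * Q).+1 * (N + N))%N -> runE pi x n f = 1 by rewrite run1 ?mulr1.
  move=> ->; rewrite (runE_blocks i0 L0 dec x _ _).1.
  exact: (all_played Nb g h i00 Q0 alpha01 q01 q_mono q1 qQ x).
move=> t i k den0; apply: divr_ge0; last exact: ltW.
pose b := (t %/ (N + N))%N; pose s := (t %% (N + N))%N.
have tE : nat_of_ord t = (b * (N + N) + s)%N by exact: divn_eq.
have sL : (s < N + N)%N by rewrite ltn_mod.
have bB : (b < (K.-1 * Q).+1)%N by rewrite ltn_divLR // -TE.
pose law a := \sum_(x : table K T) bern_table a x *
  blockE (N + N) dec x b (fun m => dec_at (N + N) dec x m i).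
have -> : Erun (T := T) P mu pi (fun w _ s => (mu i w - mu k w) * ind (tnth s t == i)) =
    EE (fun a => (a i - a k) * law a).
  pose f (u : seq 'I_K) : R := (nth i0 u (b * (N + N) + s) == i)%:R.
  transitivity (Erun (T := T) P mu pi (fun w _ u => (mu i w - mu k w) * f u)).
    apply: Ex_ext => w; apply: eq_bigr => x _; apply: eq_bigr => u _.
    by rewrite indE (tnth_nth i0) tE.
  rewrite (@ErunE _ _ _ P _ mu i0 T pi (fun a => a i - a k) f); congr EE; apply/funext => a; congr (_ * _).
  apply: eq_bigr => x _; congr (_ * _).
  by rewrite (block_marginal i0 L0 dec_valid) // -tE.
have [b0|b_gt0] := posnP b.
  have lawE a : law a = (i == i0)%:R.
    rewrite /law b0; transitivity (\sum_(x : table K T) bern_table a x * (i == i0)%:R).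
      by apply: eq_bigr => x _; congr (_ * _); exact: first_block_law.
    by rewrite -mulr_suml bern_table_sum1 mul1r.
  have [ii|ii] := eqVneq i i0; last first.
    rewrite (_ : (fun a => _) = fun=> 0) ?EE_cst //.
    by apply/funext => a; rewrite lawE (negPf ii) mulr0.
  rewrite (_ : (fun a => _) = fun a => a i - a k); last first.
    by apply/funext => a; rewrite lawE ii eqxx mulr1.
  rewrite EEB ?subr_ge0 //; [|exact: nice_coord|exact: nice_coord].
  by rewrite ii; apply: (m_sorted mu_sorted).
have [j [n [j0 nQ bE]]] : exists (j : 'I_K) n,
    [/\ (0 < j)%N, (n < Q)%N & b = (phase_start Q j + n)%N].
  by apply: (phase_decomp i0 Q0); rewrite b_gt0.
have lawE a : law a = \sum_(x : table K T) bern_table a x * block_law Nb g h alpha q x j n i.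
  apply: eq_bigr => x _; rewrite bE /dec.
  by rewrite (blockE_law h i00 Nb_le Q0 alpha01 g_neq q01 q_mono q1 qQ).
have [_ fall] := Hg j j0.
have Zbest l := boot_arm_best K_gt1 mu_meas mu01 mu_indep mu_sorted Nb_boot l j0.
(* Each recommended arm beats every other one on each piece of the law. *)
have piece (l : 'I_K) (w : ('I_K -> R) -> R) : nice w ->
    (0 <= EE (fun a => (a l - a k) * w a)) ->
    nice (fun a => (a i - a k) * (w a * (i == l)%:R)) /\
    0 <= EE (fun a => (a i - a k) * (w a * (i == l)%:R)).
  move=> nw w0; split; first by do !apply: niceM => //; exact: nice_cst.
  have [il|il] := eqVneq i l.
    by rewrite (_ : (fun a => _) = fun a => (a l - a k) * w a) //; apply/funext => a; rewrite il mulr1.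
  rewrite (_ : (fun a => _) = fun=> 0) ?EE_cst //.
  by apply/funext => a; rewrite !mulr0.
have [n0|n0] := eqVneq n 0%N.
  rewrite (_ : (fun a => _) = fun a => (a i - a k) * (Z j a * (i == j)%:R) +
      (a i - a k) * ((1 - Z j a) * (i == g j)%:R)); last first.
    by apply/funext => a; rewrite lawE sum_block_law // n0 /= -mulrDr.
  have [p1n p1v] := piece j _ (nZ j) (Zbest k).
  have [p2n p2v] := piece (g j) _ (nC j) (fall k).
  by rewrite EED // addr_ge0.
have [Hj Hh] := Halpha j n j0 (ltac:(by rewrite lt0n)).
have nW1 : nice (fun a => V j n a * A j (alpha j n) a + (q n.+1 - q n) * (1 - Z j a)).
  by apply: niceD; [exact: niceM | exact: niceZ].
have nW2 : nice (fun a => V j n a * (1 - A j (alpha j n) a)).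
  by apply: niceM => //; apply: niceB => //; exact: nice_cst.
have nW3 : nice (fun a => (1 - q n.+1) * (1 - Z j a)) by exact: niceZ.
have W3 : 0 <= EE (fun a => (a (g j) - a k) * ((1 - q n.+1) * (1 - Z j a))).
  rewrite (_ : (fun a => _) = fun a => (1 - q n.+1) * ((a (g j) - a k) * (1 - Z j a))); last first.
    by apply/funext => a; ring.
  rewrite EEZ //; last exact: niceM.
  by rewrite mulr_ge0 // subr_ge0; case/andP: (q01 n.+1).
have [p1n p1v] := piece j _ nW1 (Hj k).
have [p2n p2v] := piece (h j n) _ nW2 (Hh k).
have [p3n p3v] := piece (g j) _ nW3 W3.
rewrite (_ : (fun a => _) = fun a => (a i - a k) * ((V j n a * A j (alpha j n) a +
      (q n.+1 - q n) * (1 - Z j a)) * (i == j)%:R) +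
    (a i - a k) * (V j n a * (1 - A j (alpha j n) a) * (i == h j n)%:R) +
    (a i - a k) * ((1 - q n.+1) * (1 - Z j a) * (i == g j)%:R)); last first.
  by apply/funext => a; rewrite lawE sum_block_law // (negPf n0) -!mulrDr.
rewrite EED //; last exact: niceD.
by rewrite EED // !addr_ge0.
Qed.

(** Since [2 <= G^-1], [ln (2 / p)] is at most [Lam]. The additive 2 is absorbed by
    [2 <= G^-1 * Lam], so [Q <= 9 * G^-1 * Lam]. There are at most [K * Q] blocks of [2 * N] rounds,
    which gives 18. *)
Lemma rounds_le (Q : nat) : (0 < Q)%N -> Q%:R <= 2 * ln (2 / p) / (G / 4) + 2 ->
  (N + (N + K.-1 * Q * (N + N)))%:R <= 18 * K%:R * N%:R * G^-1 * ln (G^-1 * p^-1).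
Proof.
move=> Q0 HQ; set Lam := ln (G^-1 * p^-1).
have Gi : 4 <= G^-1 by rewrite -[4]invrK lef_pV2 ?posrE ?invr_gt0.
have pi1 : 1 <= p^-1 by rewrite invf_ge1.
have Gp : 0 < G^-1 * p^-1 by rewrite mulr_gt0 // invr_gt0.
have Lam2 : ln (2 / p) <= Lam.
  have p2 : 0 < 2 / p by rewrite divr_gt0.
  rewrite ler_ln ?posrE //; apply: ler_wpM2r; first by rewrite invr_ge0 ltW.
  by have := Gi; lra.
have Lam_half : 2^-1 <= Lam.
  have h := expR_ge1Dx (- Lam); rewrite expRN lnK ?posrE // in h.
  have h4 : (G^-1 * p^-1)^-1 <= 4^-1.
    rewrite lef_pV2 ?posrE //; have := ler_pM (ler0n R 4) (ler01) Gi pi1; lra.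
  lra.
have GL : 2 <= G^-1 * Lam.
  by have := ler_pM (ler0n R 4) (ltac:(by rewrite invr_ge0) : 0 <= 2^-1 :> R) Gi Lam_half; lra.
have HQ' : Q%:R <= 9 * (G^-1 * Lam).
  apply: le_trans HQ _; rewrite (_ : 2 * ln (2 / p) / (G / 4) = 8 * (G^-1 * ln (2 / p))); last first.
    by field; rewrite !gt_eqF.
  have : G^-1 * ln (2 / p) <= G^-1 * Lam by apply: ler_wpM2l => //; rewrite invr_ge0 ltW.
  lra.
apply: le_trans (_ : (K * Q * (N + N))%:R <= _).
  rewrite ler_nat addnA -mulSn leq_mul2r; apply/orP; right.
  by rewrite -{2}[K]prednK ?(ltnW K_gt1) // mulSn addnC -addn1 leq_add2l.
rewrite !natrM natrD.
have KN : 0 <= K%:R * N%:R :> R by rewrite mulr_ge0.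
have := ler_wpM2l KN HQ'; rewrite -/Lam; lra.
Qed.

End Construction.

Theorem theorem4p6 :
  exists Cpad C : nat,
  forall (d : measure_display) (Omega : measurableType d) (R : realType)
    (P : probability Omega R) (K : nat) (mu : 'I_K -> Omega -> R),
    (1 < K)%N ->
    (forall i, measurable_fun setT (mu i)) ->
    (forall i w, 0 <= mu i w <= 1) ->
    indep_means P mu ->
    (forall i j : 'I_K, (i <= j)%N -> prior_mean P mu j <= prior_mean P mu i) ->
    pairwise_non_dominance P mu ->
    forall (Nb N : nat), is_Nboot P mu Nb ->
    (Nb <= N)%N -> N_pad P mu Cpad%:R <= N%:R ->
    exists (T : nat) (pi : policy K),
      [/\ valid_policy pi, BIC P mu T pi, collects P mu T pi N &
          T%:R <= C%:R * K%:R * N%:R * (G_pad P mu)^-1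
                  * ln ((G_pad P mu)^-1 * (p_boot P mu Nb)^-1)].
Proof.
exists 32%N, 18%N => d Omega R P K mu K1 mu_meas mu01 mu_indep mu_sorted _ Nb N [boot _] Nb_le N_large.
have G0 : 0 < G_pad P mu := G_pad_gt0 K1 mu_meas mu01 boot.
have G4 : G_pad P mu <= 4^-1 := G_pad_le4 K1 mu_meas mu01 mu_indep mu_sorted.
(* From [ln (1 / G) >= 1 - G] and [G <= 1 / 4] the logarithm is at least [1 / 2], so the constant 32
   yields the 16 needed for estimation. *)
have N16 : 16 * G_pad P mu ^- 2 <= N%:R.
  apply: le_trans N_large; rewrite /N_pad.
  have h := expR_ge1Dx (- ln (G_pad P mu)^-1).
  rewrite expRN lnK ?posrE ?invr_gt0 // invrK in h.
  have G2 : 0 <= G_pad P mu ^- 2 by rewrite invr_ge0 exprn_ge0 // ltW.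
  have l2 : 2^-1 <= ln (G_pad P mu)^-1 by lra.
  have := ler_wpM2l G2 l2; lra.
have p0 := p_boot_gt0 K1 mu_meas mu01 boot.
have p1 : p_boot P mu Nb <= 1 := p_boot_le1 P mu_meas mu01 Nb.
have lam0 : 0 < G_pad P mu / 4 by lra.
have lam1 : G_pad P mu / 4 <= 1 by lra.
have [Q [Q0 qQ HQ]] := schedule_end p0 p1 lam0 lam1.
have [pi [pi_valid pi_bic pi_col]] :=
  exists_bic_policy K1 mu_meas mu01 mu_indep mu_sorted boot Nb_le N16 Q0 qQ.
exists (N + (N + K.-1 * Q * (N + N)))%N, pi; split => //.
exact: rounds_le.
Qed.
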